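(* Let $X>0$, $n\ge1$, let $a_0,a_1$ be $X$-periodic $\mathbb{C}^{n\times n}$-valued functions in $L^2_{\rm per}([0,X])$, and for $\sigma\in[0,2\pi)$ let $A_1(\sigma,x)=a_1(x)+2i\sigma I$, $A_0(\sigma,x)=a_0(x)-\sigma^2I+i\sigma a_1(x)$, $K(\sigma,\lambda)=\partial_x(\partial_x^2-1)^{-1}A_1(\sigma,\cdot)+(\partial_x^2-1)^{-1}(A_0(\sigma,\cdot)+(1-\lambda)I)$ on $L^2_{\rm per}([0,X];\mathbb{C}^n)$. Let $P_J$ be the orthogonal projection onto $\mathcal{H}_J=\operatorname{span}\{e^{2\pi ikx/X}v: |k|\le J, v\in\mathbb{C}^n\}$, and set $D_\sigma(\lambda)={\det}_2(I+K(\sigma,\lambda))$ and $D_{\sigma,J}(\lambda)={\det}_2(I+P_JK(\sigma,\lambda)P_J|_{\mathcal{H}_J})$. Then $D_{\sigma,J}(\lambda)\to D_\sigma(\lambda)$ as $J\to\infty$, uniformly in $\sigma\in[0,2\pi)$ and locally uniformly in $\lambda\in\mathbb{C}$.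
   Context: The multipliers act diagonally on Fourier modes $e^{2\pi ikx/X}$. The 2-modified Fredholm determinant: on finite-dimensional spaces ${\det}_2(I-A)=\det(I-A)e^{\operatorname{tr}A}$; for a Hilbert–Schmidt $A$ on a separable Hilbert space it is the limit of ${\det}_2$ of finite-dimensional compressions $P A P$ along any increasing sequence of finite-dimensional subspaces with dense union. ${\det}_2(I+K)$ means ${\det}_2(I-(-K))$. $K(\sigma,\lambda)$ is Hilbert–Schmidt. *)

(* Defs.v *)
From HB Require Import structures.
From mathcomp Require Import all_boot all_order all_algebra.
From mathcomp Require Import all_classical all_reals all_analysis.
From mathcomp Require Import complex.
Set Implicit Arguments. Unset Strict Implicit. Unset Printing Implicit Defensive.
Import Order.TTheory GRing.Theory Num.Theory.
Local Open Scope ring_scope.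
Local Open Scope classical_set_scope.

Section Defs.
Variable R : realType.
Local Notation C := (complex R).

Definition cR (x : R) : C := Complex x 0.
Definition ci : C := Complex 0 1.
Definition cabs (z : C) : R := Num.sqrt (complex.Re z ^+ 2 + complex.Im z ^+ 2).
Definition cexp (z : C) : C :=
  Complex (expR (complex.Re z) * cos (complex.Im z)) (expR (complex.Re z) * sin (complex.Im z)).

Definition cconv (u : nat -> C) (l : C) : Prop :=
  forall eps : R, 0 < eps -> exists N : nat, forall m : nat, (N <= m)%N ->
    cabs (u m - l) < eps.

(* ---------- 2-modified determinant of a finite matrix ----------
   det2 M = det_2(I + M) = det_2(I - (-M)) = det(I + M) * e^{tr(-M)} *)
Definition det2 (d : nat) (M : 'M[C]_d) : C :=
  \det (1%:M + M) * cexp (- \tr M).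

Definition zpart (f : int -> C) (N : nat) : C :=
  \sum_(k < (N + N).+1) f (k%:Z - N%:Z).
Definition zsum_to (f : int -> C) (s : C) : Prop := cconv (zpart f) s.
(* value of the sum (junk 0 if it does not converge) *)
Definition zsum (f : int -> C) : C := xget 0 [set s | zsum_to f s].

Variable n : nat.

(* ---------- the Hilbert space L^2_per([0,X]; C^n), realized through the
   orthonormal Fourier basis X^{-1/2} e^{2 pi i k x / X} e_i, i.e. as
   l^2(Z x 'I_n) ---------- *)
Definition vec := int -> 'I_n -> C.

Definition sqnorm_part (v : vec) (N : nat) : R :=
  \sum_(k < (N + N).+1) \sum_(i < n) cabs (v (k%:Z - N%:Z) i) ^+ 2.
Definition l2 (v : vec) : Prop := exists B : R, forall N, sqnorm_part v N <= B.

Definition inner (u w : vec) : C :=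
  zsum (fun k => \sum_(i < n) u k i * conjc (w k i)).

Definition vlin (d : nat) (c : 'I_d -> C) (u : 'I_d -> vec) : vec :=
  fun k i => \sum_(j < d) c j * u j k i.

(* an operator given by its matrix (kernel) in the above basis:
   (K v)(k,i) = sum_m sum_j K k i m j v(m,j) *)
Definition kernel := int -> 'I_n -> int -> 'I_n -> C.
Definition applyK (K : kernel) (v : vec) : vec :=
  fun k i => zsum (fun m => \sum_(j < n) K k i m j * v m j).

(* compression P K P|_V in an orthonormal basis u of V *)
Definition compress (K : kernel) (d : nat) (u : 'I_d -> vec) : 'M[C]_d :=
  \matrix_(p, q) inner (applyK K (u q)) (u p).

Definition orthonormal (d : nat) (u : 'I_d -> vec) : Prop :=
  (forall j, l2 (u j)) /\ forall j j', inner (u j) (u j') = (j == j')%:R.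

(* det_2(I + K) = d0 : the limit of det_2 of compressions along ANY increasing
   sequence of finite-dimensional subspaces V_m (given by orthonormal bases
   u m) with dense union *)
Definition IsDet2 (K : kernel) (d0 : C) : Prop :=
  forall (dim : nat -> nat) (u : forall m, 'I_(dim m) -> vec),
    (forall m, orthonormal (u m)) ->
    (forall m (j : 'I_(dim m)), exists c : 'I_(dim m.+1) -> C,
        u m j = vlin c (u m.+1)) ->
    (forall v, l2 v -> forall eps : R, 0 < eps -> exists m (c : 'I_(dim m) -> C),
        forall N, sqnorm_part (fun k i => v k i - vlin c (u m) k i) N <= eps) ->
    cconv (fun m => det2 (compress K (u m))) d0.

Definition HJ_index (J : nat) := ('I_(J + J).+1 * 'I_n)%type.
Definition stdbasis (J : nat) : 'I_#|{: HJ_index J}| -> vec :=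
  fun p k i => ((k == (enum_val p).1%:Z - J%:Z) && (i == (enum_val p).2))%:R.

(* ---------- Fourier coefficients of an n x n matrix function ----------
   ahat l = (1/X) int_0^X a(x) e^{-2 pi i l x / X} dx  (entrywise) *)
Definition Rint01 (X : R) (f : R -> R) : R :=
  Rintegral lebesgue_measure `[0, X] f.
Definition fcoef (X : R) (a : R -> 'M[C]_n) (l : int) : 'M[C]_n :=
  \matrix_(p, q)
    let th x := 2 * pi * l%:~R * x / X in
    Complex
      (X^-1 * Rint01 X (fun x => complex.Re (a x p q) * cos (th x) + complex.Im (a x p q) * sin (th x)))
      (X^-1 * Rint01 X (fun x => complex.Im (a x p q) * cos (th x) - complex.Re (a x p q) * sin (th x))).

Definition L2per (X : R) (a : R -> 'M[C]_n) : Prop :=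
  (forall x, a (x + X) = a x) /\
  forall p q,
    measurable_fun `[0, X] (fun x => complex.Re (a x p q)) /\
    measurable_fun `[0, X] (fun x => complex.Im (a x p q)) /\
    lebesgue_measure.-integrable `[0, X]
      (fun x => ((complex.Re (a x p q)) ^+ 2 + (complex.Im (a x p q)) ^+ 2)%:E).

(* Fourier multipliers at mode k, with xi = 2 pi k / X:
   d/dx (d^2/dx^2 - 1)^{-1}  ->  i xi / (-xi^2 - 1),
   (d^2/dx^2 - 1)^{-1}       ->  1 / (-xi^2 - 1) *)
Definition xi (X : R) (k : int) : R := 2 * pi * k%:~R / X.
Definition mult1 (X : R) (k : int) : C := ci * cR (xi X k) / cR (- (xi X k) ^+ 2 - 1).
Definition mult0 (X : R) (k : int) : C := (cR (- (xi X k) ^+ 2 - 1))^-1.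

(* Fourier coefficients of A_1(sigma,.) = a_1 + 2 i sigma I and
   A_0(sigma,.) = a_0 - sigma^2 I + i sigma a_1 *)
Definition A1hat X (a1 : R -> 'M[C]_n) (sigma : R) (l : int) : 'M[C]_n :=
  fcoef X a1 l + ((l == 0)%:R * (ci * cR (2 * sigma)))%:M.
Definition A0hat X (a0 a1 : R -> 'M[C]_n) (sigma : R) (l : int) : 'M[C]_n :=
  fcoef X a0 l + ((l == 0)%:R * cR (- sigma ^+ 2))%:M + (ci * cR sigma) *: fcoef X a1 l.

(* matrix of K(sigma,lambda) = d(d^2-1)^{-1} A_1 + (d^2-1)^{-1}(A_0 + (1-lambda) I)
   in the Fourier basis: entry (k,i),(m,j) *)
Definition Kop X (a0 a1 : R -> 'M[C]_n) (sigma : R) (lambda : C) : kernel :=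
  fun k i m j =>
    mult1 X k * A1hat X a1 sigma (k - m) i j
    + mult0 X k * (A0hat X a0 a1 sigma (k - m) i j
                   + (1 - lambda) * ((k == m) && (i == j))%:R).

Definition DJ X a0 a1 sigma lambda (J : nat) : C :=
  det2 (compress (Kop X a0 a1 sigma lambda) (@stdbasis J)).

End Defs.

(* Main.v *)
Require Import Defs.
From HB Require Import structures.
From mathcomp Require Import all_boot all_order all_algebra.
From mathcomp Require Import all_classical all_reals all_analysis.
From mathcomp Require Import complex.
From mathcomp Require Import cyclic separable cyclotomic spectral measurable_realfun.
From mathcomp Require Import ring lra zify.
Set Implicit Arguments. Unset Strict Implicit. Unset Printing Implicit Defensive.
Import Order.TTheory GRing.Theory Num.Theory.
Local Open Scope ring_scope.

(** Write [hs2 A] for the squared Hilbert-Schmidt norm of a finite matrix.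
    Schur triangularization and [x <= exp (x - 1)] give
    [|det (1 + A)|^2 <= exp (2 Re tr A + hs2 A)], hence a bound on [det2 A] by
    [hs2 A] alone.  Cauchy's estimate on the line [A + z E] turns this bound into
    a Lipschitz estimate for [det2] whose constant depends only on Hilbert-Schmidt
    norms, not on the dimension.

    For a kernel [K] with square-summable entries and an orthonormal system [u],
    let [U] be the restriction of [u] to the modes [|k| <= J] and [K_J] the
    corresponding section of [K].  The Lipschitz estimate bounds
    [det2 (compress K u) - det2 (U^* K_J U)] by the tail of the Hilbert-Schmidt
    norm of [K], uniformly in [u], and [det2 (U^* K_J U) = det2 (K_J U U^* )] by
    Sylvester's identity.  Along an increasing sequence of subspaces with dense
    union [U U^*] tends to the identity, so every such sequence has the same limit.

    The entries of [K(sigma, lambda)] satisfy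
    [|K_(k,m)|^2 <= const * (1 + xi_k^2)^-1 * b_(k-m)], where [b] is summable by
    Bessel's inequality and the constant is locally uniform in [lambda] and uniform
    in [sigma]; this makes all the estimates uniform. *)

(** * Modulus and Hilbert-Schmidt norm *)

Section Modulus.
Variable R : realType.
Local Notation C := (complex R).
Implicit Types (x y : R) (z w : C).

Lemma cabs_normE z : `|z| = (cabs z)%:C%C.
Proof. exact: normc_def. Qed.

Lemma cabs_ge0 z : 0 <= cabs z.
Proof. exact: sqrtr_ge0. Qed.

Lemma cabs_sqr z : cabs z ^+ 2 = complex.Re z ^+ 2 + complex.Im z ^+ 2.
Proof. by rewrite sqr_sqrtr // addr_ge0 // sqr_ge0. Qed.

Lemma cabsM z w : cabs (z * w) = cabs z * cabs w.
Proof. by apply: (@complexI R); rewrite -cabs_normE normrM !cabs_normE rmorphM. Qed.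

Lemma cabsD z w : cabs (z + w) <= cabs z + cabs w.
Proof. by rewrite -lecR -cabs_normE (le_trans (ler_normD _ _)) // !cabs_normE rmorphD. Qed.

Lemma cabsN z : cabs (- z) = cabs z.
Proof. by apply: (@complexI R); rewrite -!cabs_normE normrN. Qed.

Lemma cabsC z w : cabs (z - w) = cabs (w - z).
Proof. by rewrite -cabsN opprB. Qed.

Lemma cabs0 : cabs (0 : C) = 0.
Proof. by apply: (@complexI R); rewrite -cabs_normE normr0. Qed.

Lemma cabs1 : cabs (1 : C) = 1.
Proof. by apply: (@complexI R); rewrite -cabs_normE normr1. Qed.

Lemma cabs_eq0 z : cabs z = 0 -> z = 0.
Proof. by move=> h; apply/eqP; rewrite -normr_eq0 cabs_normE h. Qed.

Lemma cabsX z k : cabs (z ^+ k) = cabs z ^+ k.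
Proof. by elim: k => [|k IH]; rewrite ?expr0 ?cabs1 // !exprS cabsM IH. Qed.

Lemma cabsV z : cabs z^-1 = (cabs z)^-1.
Proof. by apply: (@complexI R); rewrite -cabs_normE normfV cabs_normE fmorphV. Qed.

Lemma cabs_conj z : cabs (conjc z) = cabs z.
Proof. by apply: (@complexI R); rewrite -!cabs_normE normcJ. Qed.

Lemma cabs_nat k : cabs (k%:R : C) = k%:R.
Proof. by apply: (@complexI R); rewrite -cabs_normE normr_nat rmorph_nat. Qed.

Lemma cabs_cR x : cabs (cR x) = `|x|.
Proof. by rewrite /cabs /= expr0n addr0 sqrtr_sqr. Qed.

Lemma cabs_ci : cabs (ci R) = 1.
Proof. by rewrite /cabs /= expr0n expr1n add0r sqrtr1. Qed.

Lemma cabs_sum (I : Type) (r : seq I) (P : pred I) (F : I -> C) :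
  cabs (\sum_(i <- r | P i) F i) <= \sum_(i <- r | P i) cabs (F i).
Proof.
elim/big_rec2 : _ => [|i y z _ h]; first by rewrite cabs0.
by rewrite (le_trans (cabsD _ _)) // lerD2l.
Qed.

Lemma cabs_prod (I : Type) (r : seq I) (P : pred I) (F : I -> C) :
  cabs (\prod_(i <- r | P i) F i) = \prod_(i <- r | P i) cabs (F i).
Proof. by apply: (big_morph _ cabsM cabs1). Qed.

Lemma mulr_conjc z : z * conjc z = (cabs z ^+ 2)%:C%C.
Proof. by rewrite -sqr_normc cabs_normE rmorphXn. Qed.

Lemma cabs_Re z : `|complex.Re z| <= cabs z.
Proof. by rewrite -lecR -cabs_normE normc_ge_Re. Qed.

Lemma cabs_Im z : `|complex.Im z| <= cabs z.
Proof.
by rewrite -sqrtr_sqr ler_wsqrtr // lerDr sqr_ge0.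
Qed.

Lemma cabs_sqrD z w : cabs (z + w) ^+ 2 <= 2 * cabs z ^+ 2 + 2 * cabs w ^+ 2.
Proof.
have := cabsD z w; have := cabs_ge0 (z + w).
have := cabs_ge0 z; have := cabs_ge0 w.
set a := cabs z; set b := cabs w; set c := cabs (z + w) => b0 a0 c0 h.
have := sqr_ge0 (a - b); nra.
Qed.

End Modulus.

Section HilbertSchmidt.
Variable R : realType.
Local Notation C := (complex R).

Definition adjm m n (A : 'M[C]_(m, n)) : 'M[C]_(n, m) := (map_mx (@conjc R) A)^T.
Definition hs2 m n (A : 'M[C]_(m, n)) : R := \sum_i \sum_j cabs (A i j) ^+ 2.

Lemma adjmM m n p (A : 'M[C]_(m, n)) (B : 'M[C]_(n, p)) :
  adjm (A *m B) = adjm B *m adjm A.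
Proof. by rewrite /adjm map_mxM trmx_mul. Qed.

Lemma adjmK m n (A : 'M[C]_(m, n)) : adjm (adjm A) = A.
Proof. by apply/matrixP => i j; rewrite !mxE conjcK. Qed.

Lemma hs2_ge0 m n (A : 'M[C]_(m, n)) : 0 <= hs2 A.
Proof. by do 2!apply: sumr_ge0 => ? _; exact: sqr_ge0. Qed.

Lemma hs2_tr m n (A : 'M[C]_(m, n)) : (hs2 A)%:C%C = \tr (A *m adjm A).
Proof.
rewrite /hs2 rmorph_sum; apply: eq_bigr => i _.
rewrite mxE rmorph_sum; apply: eq_bigr => j _.
by rewrite !mxE mulr_conjc.
Qed.

Lemma hs2_trC m n (A : 'M[C]_(m, n)) : (hs2 A)%:C%C = \tr (adjm A *m A).
Proof. by rewrite hs2_tr mxtrace_mulC. Qed.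

Lemma hs2_adjm m n (A : 'M[C]_(m, n)) : hs2 (adjm A) = hs2 A.
Proof. by apply: (@complexI R); rewrite hs2_tr hs2_trC adjmK. Qed.

Lemma hs2D m n (A B : 'M[C]_(m, n)) : hs2 (A + B) <= 2 * hs2 A + 2 * hs2 B.
Proof.
rewrite /hs2 !mulr_sumr -big_split; apply: ler_sum => i _.
rewrite !mulr_sumr -big_split; apply: ler_sum => j _.
by rewrite mxE cabs_sqrD.
Qed.

Lemma hs2N m n (A : 'M[C]_(m, n)) : hs2 (- A) = hs2 A.
Proof. by apply: eq_bigr => i _; apply: eq_bigr => j _; rewrite mxE cabsN. Qed.

Lemma hs2Z m n z (A : 'M[C]_(m, n)) : hs2 (z *: A) = cabs z ^+ 2 * hs2 A.
Proof.
rewrite /hs2 mulr_sumr; apply: eq_bigr => i _; rewrite mulr_sumr.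
by apply: eq_bigr => j _; rewrite mxE cabsM exprMn.
Qed.

Lemma hs2_eq0 m n (A : 'M[C]_(m, n)) : hs2 A = 0 -> A = 0.
Proof.
move=> h; apply/matrixP => i j; rewrite mxE; apply: cabs_eq0; apply/eqP.
have := h; rewrite /hs2.
move/eqP; rewrite psumr_eq0; last by move=> *; apply: sumr_ge0 => *; exact: sqr_ge0.
move/allP => /(_ i (mem_index_enum _)) /=.
rewrite psumr_eq0; last by move=> *; exact: sqr_ge0.
by move/allP => /(_ j (mem_index_enum _)) /=; rewrite sqrf_eq0.
Qed.

Lemma hs2_unitary n (P A : 'M[C]_n) : P *m adjm P = 1%:M ->
  hs2 (P *m A *m adjm P) = hs2 A.
Proof.
move=> hP; have hP' := mulmx1C hP.
apply: (@complexI R); rewrite !hs2_tr !adjmM adjmK.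
rewrite !mulmxA -(mulmxA _ (adjm P) P) hP' mulmx1.
by rewrite -!mulmxA mxtrace_mulC -!mulmxA hP' mulmx1.
Qed.

(** Unitary conjugation to triangular form changes neither side. The determinant is then the product
    of the diagonal entries, and [x <= expR (x - 1)] is applied with [x] the squared norm of each
    row. *)
Lemma cabs_det_le d (M : 'M[C]_d) : cabs (\det M) ^+ 2 <= expR (hs2 M - d%:R).
Proof.
case: d M => [|d] M.
  by rewrite det_mx00 cabs1 expr1n /hs2 big_ord0 subr0 expR0.
have [P hP hT] := Schur M (ltn0Sn d).
have : is_trig_mx (P *m M *m adjm P).
  rewrite /adjm map_trmx -[_ *m _](conjymx M hP).
  exact: hT.
have {hP}hP : P *m adjm P = 1%:M by rewrite /adjm map_trmx; apply/unitarymxP.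
have hP' := mulmx1C hP.
set T := P *m M *m adjm P => tT.
have -> : \det M = \det T.
  by rewrite /T !det_mulmx mulrAC -det_mulmx hP det1 mul1r.
rewrite -(hs2_unitary M hP) -/T det_trig // cabs_prod -prodrXl.
have -> : hs2 T - d.+1%:R = \sum_i (\sum_j cabs (T i j) ^+ 2 - 1).
  by rewrite sumrB sumr_const card_ord.
rewrite expR_sum; apply: ler_prod => i _; rewrite sqr_ge0 /=.
apply: (@le_trans _ _ (1 + (\sum_j cabs (T i j) ^+ 2 - 1))); last exact: expR_ge1Dx.
rewrite addrC subrK (bigD1 i) //= lerDl.
by apply: sumr_ge0 => j _; exact: sqr_ge0.
Qed.

End HilbertSchmidt.

(** * Cauchy's estimate for polynomials and the complex exponential *)

Section CauchyEstimate.
Variable R : realType.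
Local Notation C := (complex R).

(** ['X^N - 1] splits over an algebraically closed field and is separable in characteristic zero;
    its [N] distinct roots must include a primitive one. *)
Lemma primitive_root_exists N : (0 < N)%N -> exists w : C, N.-primitive_root w.
Proof.
move=> N0; pose p : {poly C} := 'X^N - 1.
have [rs Dp] := closed_field_poly_normal p.
have mp : p \is monic by exact: monicXnsubC.
rewrite (monicP mp) scale1r in Dp.
have sz : size rs = N.
  by have /eqP := size_prod_XsubC rs id; rewrite -Dp size_XnsubC // eqSS => /eqP.
have urs : uniq rs.
  rewrite -separable_prod_XsubC -Dp; apply: separable_Xn_sub_1.
  by rewrite pnatr_eq0 -lt0n.
have /hasP[w _ pw] : has N.-primitive_root rs.
  apply: has_prim_root => //; last by rewrite sz.
  by apply/allP => x xr; have : root p x by rewrite Dp root_prod_XsubC.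
by exists w.
Qed.

Lemma sum_root_of_unity N (x : C) : x ^+ N = 1 ->
  \sum_(j < N) x ^+ j = if x == 1 then N%:R else 0.
Proof.
move=> xN; case: eqP => [->|/eqP x1].
  by under eq_bigr do rewrite expr1n; rewrite sumr_const card_ord.
apply/eqP; have := subrX1 x N; rewrite xN subrr => /esym/eqP.
by rewrite mulf_eq0 subr_eq0 (negbTE x1).
Qed.

(** Discrete form of Cauchy's integral: averaging over [N] equally spaced points of the circle
    recovers the coefficient exactly once [N] exceeds the degree. *)
Lemma poly_coef_bound (p : {poly C}) (r M : R) k : 0 < r ->
  (forall z, cabs z = r -> cabs p.[z] <= M) -> cabs p`_k * r ^+ k <= M.
Proof.
(* [N] covers every coefficient of [p] and also exceeds [k], so that [w ^+ (N - k)] stands for the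
   inverse power [w ^- k]. *)
move=> r0 hM; pose N := (maxn (size p) k.+1).
have N0 : (0 < N)%N by rewrite /N; lia.
have [w pw] := primitive_root_exists N0.
have wN : w ^+ N = 1 by exact: prim_expr_order.
have w1 : cabs w = 1.
  apply/eqP; rewrite -(@pexpr_eq1 _ (cabs w) N) ?cabs_ge0 //.
  by rewrite -cabsX wN cabs1.
have key : \sum_(j < N) (w ^+ (N - k)) ^+ j * p.[cR r * w ^+ j]
    = N%:R * (p`_k * cR r ^+ k).
  under eq_bigr => j _.
    rewrite (@horner_coef_wide _ N); last by rewrite /N leq_maxl.
    rewrite mulr_sumr.
    under eq_bigr => i _.
      have -> : (w ^+ (N - k)) ^+ j * (p`_i * (cR r * w ^+ j) ^+ i) =
          p`_i * cR r ^+ i * (w ^+ (i + (N - k))) ^+ j.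
        rewrite exprMn exprD exprMn -!exprM (mulnC i j); ring.
      over.
    over.
  rewrite exchange_big /=.
  have hk : (k < N)%N by rewrite /N; lia.
  rewrite (bigD1 (Ordinal hk)) //= [X in _ + X]big1 ?addr0 => [|i ik].
    rewrite -mulr_sumr sum_root_of_unity; last by rewrite exprAC wN expr1n.
    by rewrite subnKC ?(ltnW hk) // wN eqxx mulrC.
  rewrite -mulr_sumr sum_root_of_unity; last by rewrite exprAC wN expr1n.
  (* [i + (N - k)] lies strictly between [0] and [2 * N], so divisibility by [N] would force
     [i = k]. *)
  rewrite -(prim_order_dvd pw) ifF ?mulr0 //; apply/negP => /dvdnP[q hq].
  have := ltn_ord i; have : (i : nat) != k by apply: contra ik => /eqP e; apply/eqP/val_inj.
  move: hq; case: q => [|[|q]]; nia.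
have := congr1 (@cabs R) key.
rewrite !cabsM cabs_nat cabsX cabs_cR (gtr0_norm r0) => e.
have Np : 0 < N%:R :> R by rewrite ltr0n.
rewrite -(ler_pM2l Np) -e (le_trans (cabs_sum _ _ _)) //.
rewrite mulr_natl -[X in M *+ X](card_ord N) -sumr_const; apply: ler_sum => j _.
rewrite cabsM !cabsX w1 !expr1n mul1r hM // cabsM cabs_cR (gtr0_norm r0) cabsX.
by rewrite w1 expr1n mulr1.
Qed.

Lemma geometric_tail (r : R) m : 1 < r ->
  \sum_(i < m) r ^- i.+1 <= (r - 1)^-1.
Proof.
move=> r1; have r0 : 0 < r by lra.
have -> : \sum_(i < m) r ^- i.+1 = (1 - r ^- m) / (r - 1).
  elim: m => [|m IH]; first by rewrite big_ord0 expr0 invr1 subrr mul0r.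
  rewrite big_ord_recr /= IH exprS.
  have rm : r ^+ m != 0 by rewrite expf_neq0 // gt_eqF.
  by field; rewrite rm !gt_eqF // subr_gt0.
rewrite -[leRHS]mul1r ler_pM2r ?invr_gt0 ?subr_gt0 // gerDl oppr_le0 invr_ge0.
by rewrite exprn_ge0 // ltW.
Qed.

(** The difference is the sum of the coefficients of positive degree; Cauchy's estimate bounds them
    by a geometric series of ratio [1 / r]. *)
Lemma poly_lipschitz (p : {poly C}) (r M : R) : 1 < r ->
  (forall z, cabs z = r -> cabs p.[z] <= M) -> cabs (p.[1] - p.[0]) <= M / (r - 1).
Proof.
move=> r1 hM; have r0 : 0 < r by lra.
have hc k : cabs p`_k <= M * r ^- k.
  by rewrite ler_pdivlMr ?exprn_gt0 // poly_coef_bound.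
have M0 : 0 <= M.
  by apply: le_trans (hM (cR r) _); rewrite ?cabs_ge0 // cabs_cR gtr0_norm.
rewrite (@horner_coef_wide _ (size p).+1 p 1) // big_ord_recl expr0 mulr1.
rewrite horner_coef0 addrC addKr (le_trans (cabs_sum _ _ _)) //.
apply: le_trans (ler_wpM2l M0 (geometric_tail (size p) r1)).
by rewrite mulr_sumr; apply: ler_sum => i _; rewrite expr1n mulr1.
Qed.

End CauchyEstimate.

Section Cexp.
Variable R : realType.
Local Notation C := (complex R).
Implicit Types z w : C.

Lemma cexpD z w : cexp (z + w) = cexp z * cexp w.
Proof.
case: z w => a b [c d]; rewrite /cexp /= expRD cosD sinD.
by apply/eqP; rewrite eq_complex /=; apply/andP; split; apply/eqP; ring.
Qed.

Lemma cexp0 : cexp (0 : C) = 1.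
Proof. by rewrite /cexp /= expR0 cos0 sin0 mulr1 mulr0. Qed.

Lemma cexp_natmul z k : cexp (z *+ k) = cexp z ^+ k.
Proof. by elim: k => [|k IH]; rewrite ?mulr0n ?cexp0 // mulrS exprS cexpD IH. Qed.

Lemma cabs_cexp z : cabs (cexp z) = expR (complex.Re z).
Proof.
rewrite /cabs /= !exprMn -mulrDr cos2Dsin2 mulr1 sqrtr_sqr ger0_norm // expR_ge0.
Qed.

Lemma derive0_difference_quotient (f : R -> R) (l : R) : is_derive (0 : R) 1 f l ->
  forall eps : R, 0 < eps -> exists N : nat, forall m, (N <= m)%N ->
   m.+1%:R * `| f (m.+1%:R^-1) - f 0 - m.+1%:R^-1 * l | < eps.
Proof.
move=> [df]; rewrite /derive => fl eps e0.
have /cvgrPdist_lt /(_ eps e0) := df.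
rewrite fl => -[d /= d0 hd].
exists (Num.truncn d^-1) => m Nm.
have hm : 0 < m.+1%:R^-1 :> R by rewrite invr_gt0 ltr0n.
have hmd : m.+1%:R^-1 < d.
  rewrite invf_plt ?posrE // ?ltr0n //.
  have := truncnS_gt d^-1; move/lt_le_trans; apply.
  by rewrite ler_nat ltnS.
have := hd m.+1%:R^-1.
rewrite /ball_ /= sub0r normrN gtr0_norm // => /(_ hmd (lt0r_neq0 hm)).
rewrite addr0 /GRing.scale /= mulr1 invrK distrC => h.
rewrite -[X in X * _]ger0_norm ?ler0n // -normrM mulrBr mulrA mulfV ?pnatr_eq0 //.
by rewrite mul1r.
Qed.

Lemma is_derive_expR_cos (a b : R) :
  is_derive (0 : R) 1 (fun t => expR (a * t) * cos (b * t)) a.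
Proof.
apply: is_derive_eq; rewrite !mulr0 expR0 cos0 sin0.
by rewrite /GRing.scale /=; ring.
Qed.

Lemma is_derive_expR_sin (a b : R) :
  is_derive (0 : R) 1 (fun t => expR (a * t) * sin (b * t)) b.
Proof.
apply: is_derive_eq; rewrite !mulr0 expR0 cos0 sin0.
by rewrite /GRing.scale /=; ring.
Qed.

(** The real and imaginary parts of [cexp (t w)] have derivatives [Re w] and [Im w] at [t = 0];
    sampling at [t = 1 / m.+1] leaves an error of order o(1/m). *)
Lemma cexp_first_order w (eps : R) : 0 < eps -> exists N : nat, forall m, (N <= m)%N ->
  m.+1%:R * cabs (cexp (w / m.+1%:R) - (1 + w / m.+1%:R)) < eps.
Proof.
case: w => a b e0.
have e20 : 0 < eps / 2 by rewrite divr_gt0.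
have [N1 h1] := derive0_difference_quotient (is_derive_expR_cos a b) e20.
have [N2 h2] := derive0_difference_quotient (is_derive_expR_sin a b) e20.
exists (maxn N1 N2) => m; rewrite geq_max => /andP[/h1 {}h1 /h2 {}h2].
set t : R := m.+1%:R^-1 in h1 h2 *.
have -> : Complex a b / m.+1%:R = Complex (a * t) (b * t).
  have -> : (m.+1%:R : C)^-1 = t%:C%C by rewrite /t fmorphV rmorph_nat.
  by apply/eqP; rewrite eq_complex /= !mulr0 subr0 add0r !eqxx.
rewrite !mulr0 expR0 cos0 sin0 mulr1 mulr0 subr0 in h1 h2.
have -> : cexp (Complex (a * t) (b * t)) - (1 + Complex (a * t) (b * t)) =
   cR (expR (a * t) * cos (b * t) - 1 - t * a) +
   ci R * cR (expR (a * t) * sin (b * t) - t * b).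
  by apply/eqP; rewrite eq_complex /=; apply/andP; split; apply/eqP; ring.
rewrite (splitr eps) (le_lt_trans _ (ltrD h1 h2)) // -mulrDr ler_wpM2l //.
by rewrite (le_trans (cabsD _ _)) // cabsM cabs_ci mul1r !cabs_cR.
Qed.

Lemma cabs_subX_le z w (M : R) k : cabs z <= M -> cabs w <= M ->
  cabs (z ^+ k.+1 - w ^+ k.+1) <= k.+1%:R * cabs (z - w) * M ^+ k.
Proof.
move=> zM wM; have M0 := le_trans (cabs_ge0 _) zM.
rewrite subrXX cabsM [leRHS]mulrAC [leRHS]mulrC ler_wpM2l ?cabs_ge0 //.
rewrite (le_trans (cabs_sum _ _ _)) // mulr_natl -[X in _ *+ X](card_ord k.+1).
rewrite -sumr_const; apply: ler_sum => i _.
have ik : (i <= k)%N by rewrite -ltnS.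
rewrite cabsM !cabsX /= -[X in M ^+ X](subnK ik) exprD.
by rewrite ler_pM ?exprn_ge0 ?cabs_ge0 // lerXn2r ?nnegrE ?cabs_ge0.
Qed.

(** [cexp w] is itself an [m.+1]-st power. Both bases have modulus at most [M = exp (|w| / m.+1)],
    so passing to powers costs a factor [m.+1 * M ^ m <= m.+1 * exp |w|], which the first-order
    error still beats. *)
Lemma cexp_limit w : cconv (fun N => (1 + w / N.+1%:R) ^+ N.+1) (cexp w).
Proof.
move=> eps e0; set c := expR (cabs w).
have c0 : 0 < c by exact: expR_gt0.
have [N hN] := cexp_first_order w (divr_gt0 e0 c0).
exists N => m /hN {}hN; rewrite cabsC.
have m0 : 0 < m.+1%:R :> R by [].
have -> : cexp w = cexp (w / m.+1%:R) ^+ m.+1.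
  by rewrite -cexp_natmul -[in RHS](mulr_natr (w / _)) divfK ?pnatr_eq0.
set M := expR (cabs w / m.+1%:R).
have aw : cabs (w / m.+1%:R) = cabs w / m.+1%:R by rewrite cabsM cabsV cabs_nat.
have z1 : cabs (cexp (w / m.+1%:R)) <= M.
  by rewrite cabs_cexp ler_expR -aw (le_trans (ler_norm _)) // cabs_Re.
have z2 : cabs (1 + w / m.+1%:R) <= M.
  by rewrite (le_trans (cabsD _ _)) // cabs1 aw expR_ge1Dx.
apply: le_lt_trans (cabs_subX_le m z1 z2) _.
apply: le_lt_trans (_ : _ <= m.+1%:R * cabs (cexp (w / m.+1%:R) - (1 + w / m.+1%:R)) * c) _.
  rewrite ler_wpM2l ?mulr_ge0 ?cabs_ge0 // /c.
  have -> : cabs w = cabs w / m.+1%:R * m.+1%:R by rewrite divfK // gt_eqF.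
  rewrite expRM_natr -/M exprS ler_peMl ?exprn_ge0 ?expR_ge0 // /M.
  by rewrite -expR0 ler_expR divr_ge0 ?cabs_ge0.
by rewrite -ltr_pdivlMr.
Qed.

End Cexp.

(** * The modified determinant is Lipschitz, uniformly in the dimension *)

Section Det2Lipschitz.
Variable R : realType.
Local Notation C := (complex R).
Variable d : nat.
Implicit Types A E : 'M[C]_d.

(** Subtracting [d] cancels the ones on the diagonal; this is what makes the determinant bound
    independent of the dimension. *)
Lemma hs2_1D A : hs2 (1%:M + A) - d%:R = 2 * complex.Re (\tr A) + hs2 A.
Proof.
have -> : complex.Re (\tr A) = \sum_i complex.Re (A i i).
  exact: (big_morph (@complex.Re R) (fun x y => raddfD _ x y) (raddf0 _)).
have -> : d%:R = \sum_(i < d) (1 : R) by rewrite sumr_const card_ord.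
rewrite /hs2 mulr_sumr -sumrB -big_split; apply: eq_bigr => i _ /=.
rewrite (bigD1 i) //= [X in _ = _ + X](bigD1 i) //= !mxE eqxx.
have -> : \sum_(j < d | j != i) cabs ((1%:M + A) i j) ^+ 2 =
          \sum_(j < d | j != i) cabs (A i j) ^+ 2.
  by apply: eq_bigr => j ji; rewrite !mxE eq_sym (negbTE ji) add0r.
by rewrite !cabs_sqr raddfD /= raddfD /= add0r; ring.
Qed.

Lemma cabs_det_1D_le A :
  cabs (\det (1%:M + A)) <= expR (complex.Re (\tr A) + hs2 A / 2).
Proof.
rewrite -(@ler_pXn2r _ 2) ?nnegrE ?cabs_ge0 ?expR_ge0 //.
apply: le_trans (cabs_det_le _) _.
rewrite hs2_1D -expRM_natl ler_expR.
by rewrite mulrDr mulrCA divff // mulr1.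
Qed.

(** With [n = N.+1], [|1 - w / n|^2 = 1 - 2 Re w / n + |w|^2 / n^2], to which [1 + x <= exp x]
    applies. *)
Lemma cabs_euler_le (w : C) N :
  cabs (1 - w / N.+1%:R) ^+ N.+1 <= expR (- complex.Re w + cabs w ^+ 2 / (2 * N.+1%:R)).
Proof.
have N0 : N.+1%:R != 0 :> R by rewrite pnatr_eq0.
have -> : - complex.Re w + cabs w ^+ 2 / (2 * N.+1%:R) =
   N.+1%:R * (- complex.Re w / N.+1%:R + cabs w ^+ 2 / (2 * N.+1%:R ^+ 2)).
  by field.
rewrite expRM_natl lerXn2r ?nnegrE ?cabs_ge0 ?expR_ge0 //.
rewrite -(@ler_pXn2r _ 2) ?nnegrE ?cabs_ge0 ?expR_ge0 // -expRM_natl.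
apply: le_trans (expR_ge1Dx _).
have -> : (N.+1%:R : C)^-1 = (N.+1%:R^-1)%:C%C by rewrite fmorphV rmorph_nat.
case: w => a b; rewrite !cabs_sqr /= mulr0 subr0 mulr0 add0r.
by rewrite le_eqVlt; apply/orP; left; apply/eqP; field.
Qed.

(* A polynomial-in-[A] approximation of [det2 A], so that Cauchy's estimate
   is only needed for polynomials. *)
Definition det2_approx N A : C :=
  \det (1%:M + A) * (1 - \tr A / N.+1%:R) ^+ N.+1.

(** [Re tr A] cancels between the determinant and the Euler factor, as it does in [det2]; the trace
    survives only in a term of order [1 / N]. *)
Lemma cabs_det2_approx_le N A (t h : R) :
  hs2 A <= h -> cabs (\tr A) ^+ 2 <= t ->
  cabs (det2_approx N A) <= expR (h / 2 + t / (2 * N.+1%:R)).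
Proof.
move=> hh ht; rewrite /det2_approx cabsM cabsX.
apply: le_trans (ler_pM (cabs_ge0 _) (exprn_ge0 _ (cabs_ge0 _))
  (cabs_det_1D_le A) (cabs_euler_le _ N)) _.
rewrite -expRD ler_expR addrACA subrr add0r.
by rewrite lerD ?ler_pM2r ?invr_gt0 //.
Qed.

Lemma det2_approx_cvg A : cconv (fun N => det2_approx N A) (det2 A).
Proof.
move=> eps e0; set a := cabs (\det (1%:M + A)) + 1.
have a0 : 0 < a by rewrite ltr_wpDl ?cabs_ge0.
have [N hN] := cexp_limit (- \tr A) (divr_gt0 e0 a0).
exists N => m /hN; rewrite mulNr => {}hN.
rewrite /det2_approx /det2 -mulrBr cabsM.
apply: le_lt_trans (_ : _ <= a * cabs ((1 - \tr A / m.+1%:R) ^+ m.+1 - cexp (- \tr A))) _.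
  by rewrite ler_wpM2r ?cabs_ge0 // lerDl.
by rewrite mulrC -ltr_pdivlMr.
Qed.

Definition det2_line N A E : {poly C} :=
  \det (map_mx (@polyC C) (1%:M + A) + 'X *: map_mx (@polyC C) E) *
  (1 - ((\tr A)%:P + 'X * (\tr E)%:P) * (N.+1%:R^-1)%:P) ^+ N.+1.

Lemma det2_lineE N A E z : (det2_line N A E).[z] = det2_approx N (A + z *: E).
Proof.
rewrite /det2_line /det2_approx hornerM horner_exp !hornerE mxtraceD mxtraceZ.
congr (_ * _).
rewrite -[LHS]/(horner_eval z _) -det_map_mx; congr (\det _).
by apply/matrixP => i j; rewrite !mxE /= /horner_eval !hornerE.
Qed.

(** With [|E|] the Hilbert-Schmidt norm, Cauchy's estimate is used at radius [r = 1 + 1 / |E|]: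
    there [|z E| = 1 + |E|], while [1 / (r - 1) = |E|] is the Lipschitz factor. [T] bounds the trace
    on that circle. *)
Lemma det2_approx_lipschitz N A E (T := cabs (\tr A) + (1 + (Num.sqrt (hs2 E))^-1) * cabs (\tr E)) :
  0 < hs2 E ->
  cabs (det2_approx N (A + E) - det2_approx N A) <= Num.sqrt (hs2 E) *
    expR (hs2 A + (1 + Num.sqrt (hs2 E)) ^+ 2 + T ^+ 2 / (2 * N.+1%:R)).
Proof.
move=> E0; set e := Num.sqrt (hs2 E).
have e0 : 0 < e by rewrite sqrtr_gt0.
have ee : hs2 E = e ^+ 2 by rewrite sqr_sqrtr // ltW.
pose r := 1 + e^-1.
have r1 : 1 < r by rewrite ltrDl invr_gt0.
have := @poly_lipschitz _ (det2_line N A E) r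
  (expR (hs2 A + (1 + e) ^+ 2 + T ^+ 2 / (2 * N.+1%:R))) r1.
rewrite !det2_lineE scale1r scale0r addr0 /r.
have -> : 1 + e^-1 - 1 = e^-1 by ring.
rewrite invrK [_ * e]mulrC; apply => z zr; rewrite det2_lineE.
have -> : hs2 A + (1 + e) ^+ 2 = (2 * hs2 A + 2 * (1 + e) ^+ 2) / 2 by field.
apply: cabs_det2_approx_le.
  apply: le_trans (hs2D _ _) _; rewrite lerD2l ler_pM2l // hs2Z ee -exprMn zr.
  by rewrite mulrDl mulVf ?gt_eqF // mul1r addrC.
rewrite lerXn2r ?nnegrE ?cabs_ge0 //.
  by rewrite addr_ge0 ?mulr_ge0 ?cabs_ge0 // addr_ge0 // invr_ge0 ltW.
by rewrite mxtraceD mxtraceZ (le_trans (cabsD _ _)) // lerD2l cabsM zr.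
Qed.

Lemma det2_lipschitz A E :
  cabs (det2 (A + E) - det2 A) <= Num.sqrt (hs2 E) *
    expR (hs2 A + (1 + Num.sqrt (hs2 E)) ^+ 2 + 1).
Proof.
have [E0|E0] := eqVneq (hs2 E) 0.
  by rewrite (hs2_eq0 E0) addr0 subrr cabs0 mulr_ge0 ?sqrtr_ge0 ?expR_ge0.
have {}E0 : 0 < hs2 E by rewrite lt_def E0 hs2_ge0.
apply/ler_addgt0Pr => eps e0.
have e20 : 0 < eps / 2 by rewrite divr_gt0.
have [N1 h1] := det2_approx_cvg (A + E) e20.
have [N2 h2] := det2_approx_cvg A e20.
pose T := cabs (\tr A) + (1 + (Num.sqrt (hs2 E))^-1) * cabs (\tr E).
(* Beyond [N3] the trace term is at most [1], which is the final [+ 1] in the exponent. *)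
pose N3 := Num.truncn (T ^+ 2).
pose N := maxn N1 (maxn N2 N3).
have {}h1 := h1 N (leq_maxl _ _).
have {}h2 : cabs (det2_approx N A - det2 A) < eps / 2 by apply: h2; rewrite /N; lia.
have h3 := det2_approx_lipschitz N A E0.
have Ts : T ^+ 2 / (2 * N.+1%:R) <= 1.
  rewrite ler_pdivrMr ?mulr_gt0 // mul1r.
  have := truncnS_gt (T ^+ 2); rewrite -/N3 => /ltW/le_trans; apply.
  apply: (@le_trans _ _ N.+1%:R); first by rewrite ler_nat /N; lia.
  by rewrite ler_peMl // ler1n.
have -> : det2 (A + E) - det2 A = (det2_approx N (A + E) - det2_approx N A)
   + ((det2_approx N A - det2 A) - (det2_approx N (A + E) - det2 (A + E))) by ring.
rewrite (le_trans (cabsD _ _)) // lerD //.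
  apply: le_trans h3 _.
  by rewrite ler_wpM2l ?sqrtr_ge0 // ler_expR lerD2l.
by rewrite (le_trans (cabsD _ _)) // cabsN (splitr eps) lerD // ltW.
Qed.

End Det2Lipschitz.

(** The same two block matrices multiplied in either order give block triangular products, whose
    determinants are the two sides. *)
Lemma det_1D_mulC (K : comNzRingType) m n (A : 'M[K]_(m, n)) (B : 'M[K]_(n, m)) :
  \det (1%:M + A *m B) = \det (1%:M + B *m A).
Proof.
have h1 : block_mx 1%:M (- A) B 1%:M *m block_mx 1%:M A 0 1%:M =
   block_mx 1%:M 0 B (1%:M + B *m A).
  by rewrite mulmx_block !mulmx1 !mul1mx !mulmx0 !addr0 subrr [B *m A + _]addrC.
have h2 : block_mx 1%:M A 0 1%:M *m block_mx 1%:M (- A) B 1%:M =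
   block_mx (1%:M + A *m B) 0 B 1%:M.
  by rewrite mulmx_block !mulmx1 !mul1mx !mul0mx !add0r addNr.
have := congr1 (fun M => \det M) h1; have := congr1 (fun M => \det M) h2.
by rewrite !det_mulmx !det_lblock !det_ublock !det1 !mul1r !mulr1 => -> ->.
Qed.

Lemma det2_mulC (R : realType) m n (A : 'M[complex R]_(m, n)) (B : 'M[complex R]_(n, m)) :
  det2 (A *m B) = det2 (B *m A).
Proof. by rewrite /det2 det_1D_mulC mxtrace_mulC. Qed.

(** * Symmetric sums over the integers *)

Section ComplexLimits.
Local Open Scope classical_set_scope.
Variable R : realType.
Local Notation C := (complex R).
Implicit Types (u v : nat -> C) (l : C).

Lemma cconv_cst l : cconv (fun _ => l) l.
Proof. by move=> eps e0; exists 0%N => m _; rewrite subrr cabs0. Qed.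

Lemma cconv_eventually u v l N : (forall m, (N <= m)%N -> u m = v m) ->
  cconv v l -> cconv u l.
Proof.
move=> uv h eps e0; have [M hM] := h _ e0; exists (maxn N M) => m.
by rewrite geq_max => /andP[Nm Mm]; rewrite uv // hM.
Qed.

Lemma cconv_close u l l' b N : cconv u l ->
  (forall m, (N <= m)%N -> cabs (u m - l') <= b) -> cabs (l - l') <= b.
Proof.
move=> ul h; apply/ler_addgt0Pl => eps e0; have [M hM] := ul _ e0.
have -> : l - l' = (u (maxn N M) - l') - (u (maxn N M) - l) by ring.
rewrite (le_trans (cabsD _ _)) // cabsN addrC lerD //.
  by rewrite ltW // hM // leq_maxr.
by rewrite h // leq_maxl.
Qed.

Lemma cconv_unique u l l' : cconv u l -> cconv u l' -> l = l'.
Proof.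
move=> h h'; apply/eqP; rewrite -subr_eq0; apply/eqP/cabs_eq0.
apply/eqP; rewrite eq_le cabs_ge0 andbT; apply/ler_addgt0Pl => eps e0; rewrite addr0.
have [N hN] := h' _ e0; apply: (cconv_close h (N := N)) => m /hN/ltW; exact.
Qed.

Lemma cconvD u v l l' : cconv u l -> cconv v l' -> cconv (fun m => u m + v m) (l + l').
Proof.
move=> ul vl eps e0; have e20 : 0 < eps / 2 by rewrite divr_gt0.
have [M hM] := ul _ e20; have [N hN] := vl _ e20.
exists (maxn M N) => m; rewrite geq_max => /andP[/hM {}hM /hN {}hN].
by rewrite opprD addrACA (le_lt_trans (cabsD _ _)) // (splitr eps) ltrD.
Qed.

Lemma cconvMl u l c : cconv u l -> cconv (fun m => c * u m) (c * l).
Proof.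
move=> ul eps e0; have c0 : 0 < cabs c + 1 by rewrite ltr_wpDl ?cabs_ge0.
have [M hM] := ul _ (divr_gt0 e0 c0); exists M => m /hM {}hM.
rewrite -mulrBr cabsM (@le_lt_trans _ _ ((cabs c + 1) * cabs (u m - l))) //.
  by rewrite ler_wpM2r ?cabs_ge0 // lerDl.
by rewrite mulrC -ltr_pdivlMr.
Qed.

Lemma cconvMr u l c : cconv u l -> cconv (fun m => u m * c) (l * c).
Proof. by move=> /(@cconvMl _ _ c); rewrite mulrC; under eq_fun do rewrite mulrC. Qed.

Lemma cconv_sum (I : Type) (r : seq I) (F : nat -> I -> C) (G : I -> C) :
  (forall i, cconv (F ^~ i) (G i)) ->
  cconv (fun m => \sum_(i <- r) F m i) (\sum_(i <- r) G i).
Proof.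
move=> h; elim: r => [|i r IH].
  by rewrite big_nil; under eq_fun do rewrite big_nil; exact: cconv_cst.
by rewrite big_cons; under eq_fun do rewrite big_cons; apply: cconvD.
Qed.

Lemma cconv_cauchy u :
  (forall eps : R, 0 < eps -> exists N, forall m, (N <= m)%N -> cabs (u m - u N) < eps) ->
  exists l, cconv u l.
Proof.
move=> h.
have hcvg (p : {additive C -> R}) : (forall z, `|p z| <= cabs z) ->
    cvg ((fun m => p (u m)) @ \oo).
  move=> hp; apply/cauchy_cvgP/cauchy_exP => eps e0.
  have [N hN] := h _ e0; exists (p (u N)); exists N => // m /= Nm.
  rewrite /ball /= distrC -raddfB (le_lt_trans (hp _)) // hN //.
have /cvgrPdist_lt ha := hcvg (@complex.Re R) (@cabs_Re R).
have /cvgrPdist_lt hb := hcvg (@complex.Im R) (@cabs_Im R).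
set a := lim _ in ha; set b := lim _ in hb.
exists (Complex a b) => eps e0.
have e20 : 0 < eps / 2 by rewrite divr_gt0.
have [N1 _ h1] := ha _ e20; have [N2 _ h2] := hb _ e20.
exists (maxn N1 N2) => m; rewrite geq_max => /andP[m1 m2].
have := h1 m m1; have := h2 m m2; rewrite /= => {}h2 {}h1.
have -> : u m - Complex a b = cR (complex.Re (u m) - a) + ci R * cR (complex.Im (u m) - b).
  by case: (u m) => x y; apply/eqP; rewrite eq_complex /=; apply/andP; split; apply/eqP; ring.
rewrite (le_lt_trans (cabsD _ _)) // cabsM cabs_ci mul1r !cabs_cR (splitr eps).
by rewrite ltrD // distrC.
Qed.

(** Take [N] with [s N] within [eps] of the supremum. For partial sums of a majorant this turns a
    bound into small tails. *)
Lemma bounded_eventual_increment (s : nat -> R) (B : R) :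
  (forall m, s m <= B) -> forall eps : R, 0 < eps ->
  exists N, forall m, s m - s N < eps.
Proof.
move=> sB eps e0.
have hs : has_sup (range s).
  by split; [exists (s 0%N); exists 0%N | exists B => _ [m _ <-]].
have [_ [N _ <-] hN] := sup_adherent e0 hs.
exists N => m; have : s m <= sup (range s).
  by apply: sup_upper_bound => //; exists m.
lra.
Qed.

End ComplexLimits.

Section SymmetricSums.
Variable V : zmodType.

(** [zpart] over an arbitrary [zmodType], so that complex series and their real majorants share the
    same lemmas; it is convertible with [zpart] and with [sqnorm_part]. *)
Definition zsumN (f : int -> V) (N : nat) : V :=
  \sum_(k < (N + N).+1) f (k%:Z - N%:Z).
Definition sqsum (f : int -> int -> V) (N : nat) : V :=
  zsumN (fun k => zsumN (f k) N) N.

Lemma zsumNS f N : zsumN f N.+1 = zsumN f N + (f (- N.+1%:Z) + f N.+1%:Z).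
Proof.
rewrite /zsumN addSn addnS big_ord_recl big_ord_recr /= sub0r.
have -> : (bump 0 (N + N).+1)%:Z - N.+1%:Z = N.+1%:Z.
  by rewrite /bump leq0n; lia.
rewrite addrCA; congr (_ + _).
by apply: eq_bigr => i _; congr (f _); rewrite /= /bump leq0n; lia.
Qed.

Lemma eq_zsumN f g N : f =1 g -> zsumN f N = zsumN g N.
Proof. by move=> fg; apply: eq_bigr => k _. Qed.

Lemma eq_zsumN_le f g N : (forall k, (`|k| <= N)%N -> f k = g k) -> zsumN f N = zsumN g N.
Proof. by move=> fg; apply: eq_bigr => k _; apply: fg; have := ltn_ord k; lia. Qed.

Lemma zsumN_trunc f L N : (L <= N)%N ->
  zsumN f L = zsumN (fun k => f k *+ (`|k| <= L)%N) N.
Proof.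
move=> LN; rewrite -(subnK LN); elim: (N - L)%N => [|m IH].
  by rewrite add0n; apply: eq_zsumN_le => k ->; rewrite mulr1n.
rewrite addSn zsumNS -IH.
have hl : ((m + L).+1 <= L)%N = false by lia.
by rewrite abszN absz_nat hl !mulr0n !addr0.
Qed.

Lemma zsumND f g N : zsumN (fun k => f k + g k) N = zsumN f N + zsumN g N.
Proof. exact: big_split. Qed.

Lemma zsumN_exchange (I : finType) (f : int -> I -> V) N :
  zsumN (fun k => \sum_i f k i) N = \sum_i zsumN (f^~ i) N.
Proof. exact: exchange_big. Qed.

Lemma sqsum_trunc f L N : (L <= N)%N ->
  sqsum f L = sqsum (fun k m => f k m *+ ((`|k| <= L)%N && (`|m| <= L)%N)) N.
Proof.
move=> LN; rewrite /sqsum (zsumN_trunc _ LN); apply: eq_zsumN => k.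
rewrite (zsumN_trunc _ LN); case: (_ <= L)%N => /=; first by rewrite mulr1n.
by rewrite mulr0n /zsumN big1.
Qed.

End SymmetricSums.

(** * Dominated convergence of single and double series *)

Section DominatedSums.
Variable R : realType.
Local Notation C := (complex R).

Lemma zsumN_ge0 (g : int -> R) N : (forall k, 0 <= g k) -> 0 <= zsumN g N.
Proof. by move=> g0; apply: sumr_ge0. Qed.

Lemma cabs_zsumN_le (f : int -> C) (g : int -> R) N :
  (forall k, cabs (f k) <= g k) -> cabs (zsumN f N) <= zsumN g N.
Proof. by move=> h; apply: le_trans (cabs_sum _ _ _) (ler_sum _ _). Qed.

Lemma zsumNB (V : zmodType) (f g : int -> V) N :
  zsumN f N - zsumN g N = zsumN (fun k => f k - g k) N.
Proof. by rewrite /zsumN -sumrB. Qed.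

Lemma cabs_zsumN_diff (f : int -> C) (g : int -> R) L N :
  (forall k, cabs (f k) <= g k) -> (L <= N)%N ->
  cabs (zsumN f N - zsumN f L) <= zsumN g N - zsumN g L.
Proof.
move=> fg LN; rewrite -(subnK LN); elim: (N - L)%N => [|m IH].
  by rewrite add0n !subrr cabs0.
rewrite addSn !zsumNS ![_ + (_ + _) - _]addrAC (le_trans (cabsD _ _)) // lerD //.
by rewrite (le_trans (cabsD _ _)) // lerD.
Qed.

Lemma zsumN_nondecreasing (g : int -> R) L N : (forall k, 0 <= g k) ->
  (L <= N)%N -> zsumN g L <= zsumN g N.
Proof.
move=> g0 LN; rewrite -subr_ge0.
apply: le_trans (@cabs_zsumN_diff (fun=> 0) g L N _ LN); rewrite ?cabs_ge0 // => k.
by rewrite cabs0.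
Qed.

(** A segment of row [k] lies in the square of half-side [maxn N |k|], and the other entries of that
    square are nonnegative. *)
Lemma zsumN_row_le (F : int -> int -> R) B k N : (forall k m, 0 <= F k m) ->
  (forall N, sqsum F N <= B) -> zsumN (F k) N <= B.
Proof.
move=> F0 FB; apply: (@le_trans _ _ (sqsum F (maxn N `|k|))) => //.
apply: le_trans (zsumN_nondecreasing (F0 k) (leq_maxl N `|k|)) _.
set M := maxn N `|k|.
have hk : (absz (k + M%:Z)%R < (M + M).+1)%N by rewrite /M; lia.
rewrite /sqsum {2}/zsumN (bigD1 (Ordinal hk)) //=.
have -> : (absz (k + M%:Z))%:Z - M%:Z = k by rewrite /M; lia.
by rewrite lerDl; apply: sumr_ge0 => i _; apply: zsumN_ge0.
Qed.

Lemma zsum_toE (f : int -> C) s : zsum_to f s -> zsum f = s.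
Proof.
move=> h; rewrite /zsum; case: xgetP => [y -> hy|/(_ s)] //=.
exact: cconv_unique hy h.
Qed.

Lemma zsum_dominated (f : int -> C) (g : int -> R) B :
  (forall k, cabs (f k) <= g k) -> (forall N, zsumN g N <= B) ->
  zsum_to f (zsum f).
Proof.
move=> fg gB; suff [s hs] : exists s, zsum_to f s by rewrite (zsum_toE hs).
apply: cconv_cauchy => eps e0.
have [N hN] := bounded_eventual_increment gB e0; exists N => m Nm.
exact: le_lt_trans (cabs_zsumN_diff fg Nm) (hN m).
Qed.

Section TwoDimensional.
Variables (f : int -> int -> C) (F : int -> int -> R).
Hypothesis fF : forall k m, cabs (f k m) <= F k m.

Let F0 k m : 0 <= F k m. Proof. exact: le_trans (cabs_ge0 _) (fF k m). Qed.

(** The extra entries have [|k| <= L < |m| <= N], a part of the region between the two squares. *)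
Lemma cabs_rows_diff L N : (L <= N)%N ->
  cabs (zsumN (fun k => zsumN (f k) N) L - sqsum f L) <= sqsum F N - sqsum F L.
Proof.
move=> LN; rewrite zsumNB.
apply: le_trans (cabs_zsumN_le _ (fun k => cabs_zsumN_diff (fF k) LN)) _.
rewrite -zsumNB lerD2r; apply: zsumN_nondecreasing => // k.
by apply: zsumN_ge0.
Qed.

Lemma cabs_sqsum_diff L N : (L <= N)%N ->
  cabs (sqsum f N - sqsum f L) <= sqsum F N - sqsum F L.
Proof.
move=> LN.
(* The region between the squares is split into the added full rows and the extensions of the old
   rows. *)
have -> : sqsum f N - sqsum f L =
  (zsumN (fun k => zsumN (f k) N) N - zsumN (fun k => zsumN (f k) N) L) +
  (zsumN (fun k => zsumN (f k) N) L - sqsum f L) by rewrite addrA subrK.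
apply: le_trans (cabsD _ _) _.
have h1 := @cabs_zsumN_diff (fun k => zsumN (f k) N) (fun k => zsumN (F k) N) _ _
  (fun k => cabs_zsumN_le N (fF k)) LN.
have h2 : cabs (zsumN (fun k => zsumN (f k) N) L - sqsum f L) <=
    zsumN (fun k => zsumN (F k) N) L - sqsum F L.
  rewrite !zsumNB.
  exact: cabs_zsumN_le (fun k => cabs_zsumN_diff (fF k) LN).
by apply: le_trans (lerD h1 h2) _; rewrite addrA subrK.
Qed.

(** A Fubini theorem: square sums are Cauchy because those of [F] are, and summing rows to infinity
    changes them by no more than a tail of [F]. *)
Lemma iterated_zsum_dominated B : (forall N, sqsum F N <= B) ->
  exists s, cconv (sqsum f) s /\ zsum_to (fun k => zsum (f k)) s.
Proof.
move=> FB.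
have [s hs] : exists s, cconv (sqsum f) s.
  apply: cconv_cauchy => eps e0.
  have [N hN] := bounded_eventual_increment FB e0; exists N => m Nm.
  exact: le_lt_trans (cabs_sqsum_diff Nm) (hN m).
have rowc k : zsum_to (f k) (zsum (f k)).
  by apply: (@zsum_dominated _ (F k) B) => // N; exact: zsumN_row_le.
exists s; split => // eps e0.
have e30 : 0 < eps / 3 by rewrite divr_gt0.
have [N1 h1] := hs _ e30.
have [N2 h2] := bounded_eventual_increment FB e30.
exists (maxn N1 N2) => m; rewrite geq_max => /andP[/h1 {}h1 m2].
(* The [m] rows are extended to width [N] first, at a cost bounded by the tail of [F]; then [N]
   tends to infinity. *)
have h3 : cabs (zpart (fun k => zsum (f k)) m - sqsum f m) <= eps / 3.
  have hc : cconv (fun N => zsumN (fun k => zsumN (f k) N) m) (zpart (fun k => zsum (f k)) m).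
    by apply: cconv_sum => i; exact: rowc.
  apply: (cconv_close hc (N := m)) => N mN.
  apply: le_trans (cabs_rows_diff mN) _; apply: ltW; apply: le_lt_trans (h2 N).
  rewrite lerD2l lerN2 -subr_ge0.
  exact: le_trans (cabs_ge0 _) (cabs_sqsum_diff m2).
have -> : zpart (fun k => zsum (f k)) m - s =
  (zpart (fun k => zsum (f k)) m - sqsum f m) + (sqsum f m - s) by ring.
rewrite (le_lt_trans (cabsD _ _)) //; lra.
Qed.

End TwoDimensional.
End DominatedSums.

(** * Finite sections of a kernel *)

Section MatrixLimits.
Variable R : realType.
Local Notation C := (complex R).

Lemma cconv_mulmx a b c (A : nat -> 'M[C]_(a, b)) (A' : 'M[C]_(a, b)) (B : 'M[C]_(b, c)) :
  (forall i j, cconv (fun N => A N i j) (A' i j)) ->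
  forall i j, cconv (fun N => (A N *m B) i j) ((A' *m B) i j).
Proof.
move=> h i j; rewrite mxE; under eq_fun do rewrite mxE.
by apply: cconv_sum => l; apply: cconvMr.
Qed.

Lemma cconv_mulmxl a b c (A : nat -> 'M[C]_(b, c)) (A' : 'M[C]_(b, c)) (B : 'M[C]_(a, b)) :
  (forall i j, cconv (fun N => A N i j) (A' i j)) ->
  forall i j, cconv (fun N => (B *m A N) i j) ((B *m A') i j).
Proof.
move=> h i j; rewrite mxE; under eq_fun do rewrite mxE.
by apply: cconv_sum => l; apply: cconvMl.
Qed.

Lemma cconv_mxtrace a (A : nat -> 'M[C]_a) (A' : 'M[C]_a) :
  (forall i j, cconv (fun N => A N i j) (A' i j)) ->
  cconv (fun N => \tr (A N)) (\tr A').
Proof. by move=> h; apply: cconv_sum. Qed.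

Lemma hs2_cconv a b (A : nat -> 'M[C]_(a, b)) (A' : 'M[C]_(a, b)) :
  (forall i j, cconv (fun N => A N i j) (A' i j)) ->
  forall eps : R, 0 < eps -> exists N, forall m, (N <= m)%N -> hs2 (A m - A') < eps.
Proof.
move=> h eps e0.
have key : cconv (fun m => \sum_i \sum_j cR (cabs ((A m - A') i j) ^+ 2))
                 (\sum_(i < a) \sum_(j < b) 0).
  apply: cconv_sum => i; apply: cconv_sum => j del d0.
  have d1 : 0 < Num.sqrt del by rewrite sqrtr_gt0.
  have [N hN] := h i j _ d1; exists N => m /hN {}hN.
  rewrite subr0 cabs_cR ger0_norm ?sqr_ge0 // !mxE -(sqr_sqrtr (ltW d0)).
  by rewrite ltrXn2r ?nnegrE ?cabs_ge0 ?sqrtr_ge0.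
have [N hN] := key _ e0; exists N => m /hN.
rewrite [X in _ - X]big1 => [|i _]; last by rewrite big1.
rewrite subr0.
have -> : \sum_i \sum_j cR (cabs ((A m - A') i j) ^+ 2) = cR (hs2 (A m - A')).
  rewrite -[RHS]/((hs2 (A m - A'))%:C)%C /hs2 rmorph_sum; apply: eq_bigr => i _.
  by rewrite rmorph_sum.
by rewrite cabs_cR ger0_norm // hs2_ge0.
Qed.

Lemma hs2B a b (X Y : 'M[C]_(a, b)) :
  hs2 (X - Y) = hs2 X + hs2 Y - 2 * complex.Re (\tr (adjm X *m Y)).
Proof.
have -> : complex.Re (\tr (adjm X *m Y)) =
    \sum_i \sum_j complex.Re (conjc (X i j) * Y i j).
  rewrite mxtrace_mulC /mxtrace raddf_sum; apply: eq_bigr => i _.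
  by rewrite mxE raddf_sum; apply: eq_bigr => j _; rewrite !mxE mulrC.
rewrite /hs2 mulr_sumr -big_split -sumrB; apply: eq_bigr => i _ /=.
rewrite mulr_sumr -big_split -sumrB; apply: eq_bigr => j _ /=.
rewrite !mxE !cabs_sqr.
by case: (X i j) (Y i j) => x1 x2 [y1 y2] /=; ring.
Qed.

Lemma Re_tr_adjm_le a b (X Y : 'M[C]_(a, b)) :
  2 * complex.Re (\tr (adjm X *m Y)) <= hs2 X + hs2 Y.
Proof. by rewrite -subr_ge0 -hs2B hs2_ge0. Qed.

(** Operator norm at most one, tested on matrices of any width so that it applies directly to
    [hs2]. *)
Definition contractive a b (W : 'M[C]_(a, b)) : Prop :=
  forall c (X : 'M[C]_(b, c)), hs2 (W *m X) <= hs2 X.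

Lemma hs2_Re_tr a b (X : 'M[C]_(a, b)) : hs2 X = complex.Re (\tr (adjm X *m X)).
Proof. by rewrite -hs2_trC. Qed.

(* [hs2 (W^* X) = Re tr (X^* W W^* X)], so Young's inequality suffices. *)
Lemma contractive_adjm a b (W : 'M[C]_(a, b)) : contractive W -> contractive (adjm W).
Proof.
move=> hW c X; have := Re_tr_adjm_le X (W *m (adjm W *m X)).
have -> : adjm X *m (W *m (adjm W *m X)) = adjm (adjm W *m X) *m (adjm W *m X).
  by rewrite adjmM adjmK !mulmxA.
rewrite -hs2_Re_tr; have := hW _ (adjm W *m X); lra.
Qed.

(** Contract from the left, then pass to the adjoint to contract from the right. *)
Lemma hs2_compression_le a b (W : 'M[C]_(a, b)) M : contractive W ->
  hs2 (adjm W *m M *m W) <= hs2 M.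
Proof.
move=> hW; rewrite -mulmxA.
apply: le_trans (contractive_adjm hW _) _.
rewrite -hs2_adjm adjmM; apply: le_trans (contractive_adjm hW _) _.
by rewrite hs2_adjm.
Qed.

Lemma det2_uniform_continuity (c eps : R) : 0 < eps -> exists del : R, 0 < del /\
  forall d (A B : 'M[C]_d), hs2 A <= c -> hs2 (B - A) <= del ->
  cabs (det2 B - det2 A) <= eps.
Proof.
(* The [4] is [(1 + 1) ^+ 2]: capping [hs2 (B - A)] by [1] bounds the exponent of the Lipschitz
   constant. *)
move=> e0; set L := expR (c + 4 + 1).
have L0 : 0 < L by exact: expR_gt0.
exists (Num.min 1 ((eps / L) ^+ 2)); split.
  by rewrite lt_min ltr01 exprn_gt0 // divr_gt0.
move=> d A B Ac; rewrite le_min => /andP[h1 h2].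
have s1 : Num.sqrt (hs2 (B - A)) <= 1 by rewrite -sqrtr1 ler_wsqrtr.
have s2 : Num.sqrt (hs2 (B - A)) <= eps / L.
  have l0 : 0 <= eps / L by rewrite ltW ?divr_gt0.
  by rewrite -(ger0_norm l0) -sqrtr_sqr ler_wsqrtr.
have := det2_lipschitz A (B - A); rewrite [A + _]addrC subrK => /le_trans; apply.
rewrite -[leRHS](divfK (lt0r_neq0 L0)) ler_pM ?sqrtr_ge0 ?expR_ge0 // ler_expR.
have := sqrtr_ge0 (hs2 (B - A)); nra.
Qed.

Lemma det2_cconv d (A : nat -> 'M[C]_d) (A' : 'M[C]_d) :
  (forall i j, cconv (fun N => A N i j) (A' i j)) ->
  cconv (fun N => det2 (A N)) (det2 A').
Proof.
move=> h eps e0; have e20 : 0 < eps / 2 by rewrite divr_gt0.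
have [del [d0 hd]] := det2_uniform_continuity (hs2 A') e20.
have [N hN] := hs2_cconv h d0; exists N => m /hN/ltW/(hd _ _ _ (lexx _)) hm.
by apply: le_lt_trans hm _; rewrite ltr_pdivrMr // ltr_pMr // ltr1n.
Qed.

End MatrixLimits.

Section FiniteSections.
Variables (R : realType) (n : nat).
Local Notation C := (complex R).
Local Notation vec := (vec R n).
Local Notation kernel := (Defs.kernel R n).

Definition dimH (N : nat) := #|{: HJ_index n N}|.
Definition mode N (p : 'I_(dimH N)) : int := (enum_val p).1%:Z - N%:Z.
Definition component N (p : 'I_(dimH N)) : 'I_n := (enum_val p).2.
Definition matN (K : kernel) N : 'M[C]_(dimH N) :=
  \matrix_(p, q) K (mode p) (component p) (mode q) (component q).
Definition colN d (u : 'I_d -> vec) N : 'M[C]_(dimH N, d) :=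
  \matrix_(p, j) u j (mode p) (component p).

Lemma mode_le N (p : 'I_(dimH N)) : (`|mode p| <= N)%N.
Proof. by rewrite /mode; have := ltn_ord (enum_val p).1; lia. Qed.

Lemma mode_component_inj N (p q : 'I_(dimH N)) :
  (mode p == mode q) && (component p == component q) = (p == q).
Proof.
apply/andP/eqP => [[/eqP h1 /eqP h2]|->]; last by rewrite !eqxx.
apply: enum_val_inj; rewrite [LHS]surjective_pairing [RHS]surjective_pairing.
congr (_, _) => //; apply: val_inj.
by have := addIr _ h1 => -[].
Qed.

Lemma sum_modes (V : zmodType) (F : int -> 'I_n -> V) N :
  \sum_(p < dimH N) F (mode p) (component p) = zsumN (fun k => \sum_i F k i) N.
Proof.
rewrite /zsumN pair_bigA /=.
by rewrite (big_enum_val (fun x : HJ_index n N => F (x.1%:Z - N%:Z) x.2)).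
Qed.

(** Recognises the finite product as a square partial sum of the double series for
    [inner (applyK K (u q)) (u p)]. *)
Lemma compression_entry (K : kernel) d (u : 'I_d -> vec) N p q :
  (adjm (colN u N) *m matN K N *m colN u N) p q =
  sqsum (fun k m => \sum_i \sum_j K k i m j * u q m j * conjc (u p k i)) N.
Proof.
rewrite -mulmxA mxE.
transitivity (\sum_(a < dimH N) conjc (u p (mode a) (component a)) *
   \sum_(b < dimH N) K (mode a) (component a) (mode b) (component b) * u q (mode b) (component b)).
  apply: eq_bigr => a _; rewrite !mxE; congr (_ * _).
  by apply: eq_bigr => b _; rewrite !mxE.
rewrite (sum_modes (fun k i => conjc (u p k i) *
   \sum_(b < dimH N) K k i (mode b) (component b) * u q (mode b) (component b))).
apply: eq_zsumN => k; rewrite zsumN_exchange; apply: eq_bigr => i _.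
rewrite (sum_modes (fun m j => K k i m j * u q m j)) mulr_sumr.
apply: eq_bigr => m _; rewrite mulr_sumr; apply: eq_bigr => j _.
by rewrite mulrC.
Qed.

Definition dominated (h : int -> int -> R) (K : kernel) : Prop :=
  forall k i m j, cabs (K k i m j) ^+ 2 <= h k m.

Lemma sum_const2 (c : R) : \sum_(i < n) \sum_(j < n) c = n%:R ^+ 2 * c.
Proof. by rewrite !sumr_const card_ord -mulrnA -[LHS]mulr_natl natrM expr2. Qed.

Lemma hs2_matN_le K h N : dominated h K ->
  hs2 (matN K N) <= n%:R ^+ 2 * sqsum h N.
Proof.
move=> hK.
have -> : hs2 (matN K N) = sqsum (fun k m => \sum_i \sum_j cabs (K k i m j) ^+ 2) N.
  rewrite /hs2.
  transitivity (\sum_(a < dimH N) \sum_(b < dimH N)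
      cabs (K (mode a) (component a) (mode b) (component b)) ^+ 2).
    by apply: eq_bigr => a _; apply: eq_bigr => b _; rewrite mxE.
  rewrite (sum_modes (fun k i => \sum_(b < dimH N) cabs (K k i (mode b) (component b)) ^+ 2)).
  apply: eq_zsumN => k; rewrite zsumN_exchange; apply: eq_bigr => i _.
  by rewrite (sum_modes (fun m j => cabs (K k i m j) ^+ 2)).
rewrite /sqsum /zsumN mulr_sumr; apply: ler_sum => k _.
rewrite mulr_sumr; apply: ler_sum => m _.
have -> : n%:R ^+ 2 * h (k%:Z - N%:Z) (m%:Z - N%:Z) =
   \sum_(i < n) \sum_(j < n) h (k%:Z - N%:Z) (m%:Z - N%:Z).
  by rewrite sum_const2.
by apply: ler_sum => i _; apply: ler_sum => j _.
Qed.

(** Cuts the kernel without changing the index set, so that its difference with [K] makes sense at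
    every size [dimH N]. *)
Definition truncK J (K : kernel) : kernel :=
  fun k i m j => K k i m j *+ ((`|k| <= J)%N && (`|m| <= J)%N).

Lemma compression_trunc K d (u : 'I_d -> vec) J N : (J <= N)%N ->
  adjm (colN u N) *m matN (truncK J K) N *m colN u N =
  adjm (colN u J) *m matN K J *m colN u J.
Proof.
move=> JN; apply/matrixP => p q; rewrite !compression_entry (sqsum_trunc _ JN).
apply: eq_zsumN => k; apply: eq_zsumN => m; rewrite /truncK.
case: (_ && _); first by rewrite mulr1n; do 2!apply: eq_bigr => ? _; rewrite mulr1n.
by rewrite mulr0n !big1 // => i _; rewrite big1 // => j _; rewrite mulr0n !mul0r.
Qed.

Lemma hs2_trunc_le K h J N : dominated h K -> (J <= N)%N ->
  hs2 (matN K N - matN (truncK J K) N) <= n%:R ^+ 2 * (sqsum h N - sqsum h J).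
Proof.
move=> hK JN.
pose b k m := (`|k : int| <= J)%N && (`|m : int| <= J)%N.
have -> : sqsum h N - sqsum h J = sqsum (fun k m => h k m - h k m *+ b k m) N.
  by rewrite (sqsum_trunc h JN) /sqsum zsumNB; apply: eq_zsumN => k; rewrite zsumNB.
have -> : matN K N - matN (truncK J K) N =
    matN (fun k i m j => K k i m j - truncK J K k i m j) N.
  by apply/matrixP => p q; rewrite !mxE.
apply: hs2_matN_le => k i m j; rewrite /truncK /b.
by case: (_ && _); rewrite ?mulr1n ?mulr0n ?subr0 ?subrr ?cabs0 ?expr0n.
Qed.

End FiniteSections.

(** * Compressions to orthonormal systems *)

Section Compressions.
Local Open Scope classical_set_scope.
Variables (R : realType) (n : nat).
Local Notation C := (complex R).
Local Notation vec := (vec R n).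
Local Notation kernel := (Defs.kernel R n).

Lemma inner_cvg (v w : vec) : l2 v -> l2 w ->
  zsum_to (fun k => \sum_i v k i * conjc (w k i)) (inner v w).
Proof.
move=> [B1 h1] [B2 h2].
apply: (@zsum_dominated _ _ (fun k => \sum_i cabs (v k i) ^+ 2 + \sum_i cabs (w k i) ^+ 2)
  (B1 + B2)).
  move=> k; apply: le_trans (cabs_sum _ _ _) _; rewrite -big_split /=.
  apply: ler_sum => i _; rewrite cabsM cabs_conj.
  have := cabs_ge0 (v k i); have := cabs_ge0 (w k i); nra.
by move=> N; rewrite zsumND; exact: lerD (h1 N) (h2 N).
Qed.

Lemma gram_cvg d (u : 'I_d -> vec) : Defs.orthonormal u -> forall i j,
  cconv (fun N => (adjm (colN u N) *m colN u N) i j) ((1%:M : 'M[C]_d) i j).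
Proof.
move=> [ul ui] i j; rewrite mxE eq_sym -ui.
apply: (@cconv_eventually _ _ _ _ 0) (inner_cvg (ul j) (ul i)) => N _.
rewrite mxE -[RHS]/(zsumN _ N) -(sum_modes (fun k l => u j k l * conjc (u i k l))).
by apply: eq_bigr => a _; rewrite !mxE mulrC.
Qed.

(** Parseval: the Gram matrices of the truncated vectors tend to the identity. *)
Lemma hs2_colN_cvg d (u : 'I_d -> vec) e (A : 'M[C]_(d, e)) : Defs.orthonormal u ->
  cconv (fun N => (hs2 (colN u N *m A))%:C%C) (hs2 A)%:C%C.
Proof.
move=> ou; rewrite hs2_trC -[X in X *m A]mulmx1.
apply: (@cconv_eventually _ _
  (fun N => \tr (adjm A *m (adjm (colN u N) *m colN u N) *m A)) _ 0).
  by move=> N _; rewrite hs2_trC adjmM !mulmxA.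
by apply: cconv_mxtrace; apply: cconv_mulmx; apply: cconv_mulmxl; apply: gram_cvg.
Qed.

(** [hs2 (colN u N *m A)] is nondecreasing in [N], as a sum of nonnegative terms over more modes,
    and its limit is [hs2 A]. *)
Lemma colN_contractive d (u : 'I_d -> vec) N : Defs.orthonormal u -> contractive (colN u N).
Proof.
move=> ou e A.
pose g k := \sum_(i < n) \sum_(l < e) cabs (\sum_(j < d) u j k i * A j l) ^+ 2.
have hg M : hs2 (colN u M *m A) = zsumN g M.
  rewrite /g -sum_modes; apply: eq_bigr => a _; apply: eq_bigr => l _.
  by rewrite mxE; congr (cabs _ ^+ 2); apply: eq_bigr => j _; rewrite mxE.
apply/ler_addgt0Pr => eps e0.
have [M hM] := hs2_colN_cvg A ou e0.
have := hM (maxn N M) (leq_maxr _ _); rewrite -rmorphB /= -[X in cabs X]/(cR _) cabs_cR.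
move/(le_lt_trans (ler_norm _)) => h.
have : hs2 (colN u N *m A) <= hs2 (colN u (maxn N M) *m A).
  rewrite !hg; apply: zsumN_nondecreasing; last exact: leq_maxl.
  by move=> k; do 2!apply: sumr_ge0 => ? _; exact: sqr_ge0.
lra.
Qed.

Section Dominated.
Variables (h : int -> int -> R) (B : R).
Hypothesis hB : forall N, sqsum h N <= B.

Lemma sqsum_mul (a b : int -> R) N :
  sqsum (fun k m => a k * b m) N = zsumN a N * zsumN b N.
Proof.
rewrite /sqsum /zsumN mulr_suml; apply: eq_bigr => k _.
by rewrite mulr_sumr.
Qed.

(** The double series for [inner] has the summable majorant [|K|^2 + |u_p|^2 |u_q|^2], so its square
    sums converge to the iterated sum that defines [compress]. *)
Lemma compression_cvg (K : kernel) d (u : 'I_d -> vec) : dominated h K ->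
  (forall j, l2 (u j)) -> forall p q,
  cconv (fun N => (adjm (colN u N) *m matN K N *m colN u N) p q) (compress K u p q).
Proof.
move=> hK ul p q.
pose f k m := \sum_i \sum_j K k i m j * u q m j * conjc (u p k i).
apply: (@cconv_eventually _ _ (sqsum f) _ 0) => [N _|]; first by rewrite compression_entry.
pose sq (v : vec) k := \sum_i cabs (v k i) ^+ 2.
have [B1 h1] := ul p; have [B2 h2] := ul q.
have sq0 v k : 0 <= sq v k by apply: sumr_ge0 => i _; exact: sqr_ge0.
have fF k m : cabs (f k m) <= n%:R ^+ 2 * h k m + sq (u p) k * sq (u q) m.
  apply: le_trans (cabs_sum _ _ _) _.
  have -> : n%:R ^+ 2 * h k m + sq (u p) k * sq (u q) m =
    \sum_(i < n) \sum_(j < n) (h k m + cabs (u p k i) ^+ 2 * cabs (u q m j) ^+ 2).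
    under eq_bigr do rewrite big_split /=.
    rewrite big_split /= sum_const2; congr (_ + _).
    by rewrite mulr_suml; apply: eq_bigr => i _; rewrite mulr_sumr.
  apply: ler_sum => i _; apply: le_trans (cabs_sum _ _ _) _.
  apply: ler_sum => j _; rewrite !cabsM cabs_conj -mulrA -exprMn.
  have := hK k i m j; have := cabs_ge0 (K k i m j).
  have : 0 <= cabs (u p k i) * cabs (u q m j) by rewrite mulr_ge0 ?cabs_ge0.
  rewrite [cabs (u q m j) * _]mulrC; set y := cabs _ * _; set x := cabs _; nra.
have [|s [hs1 hs2]] := @iterated_zsum_dominated _ f _ fF (n%:R ^+ 2 * B + B1 * B2).
  move=> N; have -> : sqsum (fun k m => n%:R ^+ 2 * h k m + sq (u p) k * sq (u q) m) N =
     n%:R ^+ 2 * sqsum h N + zsumN (sq (u p)) N * zsumN (sq (u q)) N.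
    have -> : n%:R ^+ 2 * sqsum h N =
        zsumN (fun k => zsumN (fun m => n%:R ^+ 2 * h k m) N) N.
      by rewrite /sqsum /zsumN mulr_sumr; apply: eq_bigr => k _; rewrite mulr_sumr.
    by rewrite -sqsum_mul -zsumND; apply: eq_zsumN => k; rewrite zsumND.
  apply: lerD; first by rewrite ler_wpM2l ?exprn_ge0.
  by apply: ler_pM; [exact: zsumN_ge0|exact: zsumN_ge0|exact: h1|exact: h2].
have rowc k i : zsum_to (fun m => \sum_j K k i m j * u q m j)
                        (applyK K (u q) k i).
  have Kl2 : forall N, zsumN (h k) N <= B.
    move=> N; apply: zsumN_row_le => // k' m'.
    exact: le_trans (sqr_ge0 _) (hK k' i m' i).
  apply: (@zsum_dominated _ _ (fun m => n%:R * h k m + sq (u q) m) (n%:R * B + B2)).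
    move=> m; apply: le_trans (cabs_sum _ _ _) _.
    have -> : n%:R * h k m + sq (u q) m = \sum_(j < n) (h k m + cabs (u q m j) ^+ 2).
      by rewrite big_split /= sumr_const card_ord -[h k m *+ n]mulr_natl.
    apply: ler_sum => j _; rewrite cabsM.
    have := hK k i m j; have := cabs_ge0 (K k i m j); have := cabs_ge0 (u q m j).
    set y := cabs _; set x := cabs _; nra.
  move=> N; rewrite zsumND {1}/zsumN -mulr_sumr.
  by apply: lerD; [rewrite ler_wpM2l //; exact: Kl2|exact: h2].
rewrite /compress mxE /inner.
(* [compress] sums over [i] after the limit in [m], and [f] before it; a finite sum passes through
   the limit. *)
suff -> : (fun k => \sum_i applyK K (u q) k i * conjc (u p k i)) = (fun k => zsum (f k)).
  by rewrite (zsum_toE hs2).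
apply/funext => k; apply/esym/zsum_toE.
apply: (@cconv_eventually _ _ (fun N => \sum_i zpart (fun m => \sum_j K k i m j * u q m j) N
   * conjc (u p k i)) _ 0) => [N _|]; last first.
  by apply: cconv_sum => i; apply: cconvMr; exact: rowc.
rewrite -[LHS]/(zsumN _ N) /f zsumN_exchange; apply: eq_bigr => i _.
rewrite /zpart mulr_suml; apply: eq_bigr => m _.
by rewrite mulr_suml.
Qed.

(** At large [N], [K] and [truncK J K] are compressed by the same contraction, so they differ by at
    most the tail of [h] beyond [J]; then [N] tends to infinity. [J0] is chosen before [K], [d] and
    [u]. *)
Lemma section_close (eps : R) : (forall k m, 0 <= h k m) -> 0 < eps ->
  exists J0, forall J, (J0 <= J)%N ->
  forall (K : kernel), dominated h K -> forall d (u : 'I_d -> vec), Defs.orthonormal u ->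
  cabs (det2 (compress K u) - det2 (adjm (colN u J) *m matN K J *m colN u J)) <= eps.
Proof.
move=> h0 e0.
have [del [d0 hd]] := @det2_uniform_continuity R (n%:R ^+ 2 * B) _ e0.
(* The tail gets multiplied by [n%:R ^+ 2]; adding one keeps the divisor positive when [n = 0]. *)
have [J0 hJ0] := bounded_eventual_increment hB (divr_gt0 d0 (ltr_wpDl (sqr_ge0 n%:R) ltr01)).
exists J0 => J J0J K hK d u ou.
have hcv : cconv (fun N => det2 (adjm (colN u N) *m matN K N *m colN u N))
                 (det2 (compress K u)).
  by apply: det2_cconv => p q; apply: compression_cvg => //; exact: ou.1.
apply: (cconv_close hcv (N := J)) => N JN.
apply: hd.
  apply: le_trans (hs2_compression_le _ (colN_contractive _ ou)) _.
  by apply: le_trans (hs2_matN_le J hK) _; rewrite ler_wpM2l ?exprn_ge0.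
rewrite -(compression_trunc K u JN) -mulmxBl -mulmxBr.
apply: le_trans (hs2_compression_le _ (colN_contractive _ ou)) _.
apply: le_trans (hs2_trunc_le hK JN) _.
have hm : sqsum h J0 <= sqsum h J.
  rewrite -subr_ge0; apply: le_trans (cabs_ge0 _) (@cabs_sqsum_diff _ (fun _ _ => 0) h _ _ _ J0J).
  by move=> k m; rewrite cabs0.
have hm' : 0 <= sqsum h N - sqsum h J.
  apply: le_trans (cabs_ge0 _) (@cabs_sqsum_diff _ (fun _ _ => 0) h _ _ _ JN).
  by move=> k m; rewrite cabs0.
have := hJ0 N; rewrite ltr_pdivlMr ?ltr_wpDl ?sqr_ge0 //.
have : 0 <= n%:R ^+ 2 :> R by exact: sqr_ge0.
set y := _ ^+ 2; nra.
Qed.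

End Dominated.
End Compressions.

(** * Independence of the exhausting sequence *)

Section StandardBasis.
Local Open Scope classical_set_scope.
Variables (R : realType) (n : nat).
Local Notation C := (complex R).
Local Notation vec := (vec R n).
Local Notation kernel := (Defs.kernel R n).
Local Notation e_ J := (@stdbasis R n J).

Lemma stdbasisE J (a : 'I_(dimH n J)) k i :
  e_ J a k i = ((k == mode a) && (i == component a))%:R.
Proof. by []. Qed.

Lemma stdbasis_eval J (a : 'I_(dimH n J)) (w : vec) N : (J <= N)%N ->
  zsumN (fun k => \sum_i conjc (e_ J a k i) * w k i) N = w (mode a) (component a).
Proof.
move=> JN.
have -> : zsumN (fun k => \sum_i conjc (e_ J a k i) * w k i) N =
          zsumN (fun k => \sum_i conjc (e_ J a k i) * w k i) J.
  rewrite [RHS](zsumN_trunc _ JN); apply: eq_zsumN => k.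
  case: leqP => kJ /=; rewrite ?mulr1n ?mulr0n //.
  rewrite big1 // => i _; rewrite stdbasisE.
  have -> : (k == mode a) = false.
    by apply/negP => /eqP ka; move: kJ; rewrite ka ltnNge mode_le.
  by rewrite conjc0 mul0r.
rewrite -sum_modes (bigD1 a) //= big1 ?addr0 => [|b ba].
  by rewrite stdbasisE !eqxx conjc1 mul1r.
by rewrite stdbasisE mode_component_inj (negbTE ba) conjc0 mul0r.
Qed.

Lemma stdbasis_dot J (a b : 'I_(dimH n J)) N : (J <= N)%N ->
  zsumN (fun k => \sum_i conjc (e_ J a k i) * e_ J b k i) N = (a == b)%:R.
Proof. by move=> JN; rewrite stdbasis_eval // stdbasisE mode_component_inj. Qed.

Lemma conjc_stdbasis J (a : 'I_(dimH n J)) k i : conjc (e_ J a k i) = e_ J a k i.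
Proof. by rewrite stdbasisE conjc_nat. Qed.

Lemma sqnorm_stdbasis J (a : 'I_(dimH n J)) N : (J <= N)%N -> sqnorm_part (e_ J a) N = 1.
Proof.
move=> JN; apply: (@complexI R).
transitivity (zsumN (fun k => \sum_i conjc (e_ J a k i) * e_ J a k i) N).
  rewrite rmorph_sum; apply: eq_bigr => k _; rewrite rmorph_sum.
  by apply: eq_bigr => i _; rewrite mulrC mulr_conjc.
by rewrite stdbasis_dot // eqxx.
Qed.

Lemma stdbasis_orthonormal J : Defs.orthonormal (e_ J).
Proof.
split=> [a|a b].
  exists 1 => N; rewrite -(sqnorm_stdbasis a (leq_maxr N J)).
  apply: (@zsumN_nondecreasing _ (fun k => \sum_i cabs (e_ J a k i) ^+ 2)).
    by move=> k; apply: sumr_ge0 => i _; exact: sqr_ge0.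
  exact: leq_maxl.
apply: zsum_toE; apply: (@cconv_eventually _ _ _ _ J) (cconv_cst _) => N JN.
rewrite -(stdbasis_dot a b JN); apply: eq_bigr => k _; apply: eq_bigr => i _.
by rewrite !conjc_stdbasis.
Qed.

(** The standard basis at level [N] contains every mode of level [J], so here Sylvester's identity
    returns the section [matN K J] itself, with no limit in between. *)
Lemma colN_stdbasis J N : (J <= N)%N -> colN (e_ N) J *m adjm (colN (e_ N) J) = 1%:M.
Proof.
move=> JN; apply/matrixP => a b; rewrite !mxE eq_sym -(stdbasis_dot b a JN) -sum_modes.
apply: eq_bigr => p _; rewrite !mxE mulrC !stdbasisE.
by rewrite ![mode p == _]eq_sym ![component p == _]eq_sym.
Qed.

(** Best approximation: with [e] the coordinate vector of [a] and [U = colN u J], the squared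
    distance [1 + |x|^2 - 2 Re <U^* e, x>] is at least [1 - |U^* e|^2] for every coefficient vector
    [x]. *)
Lemma density_stdbasis d (u : 'I_d -> vec) J (a : 'I_(dimH n J)) c (eps : R) :
  Defs.orthonormal u ->
  (forall N, sqnorm_part (fun k i => e_ J a k i - vlin c u k i) N <= eps) ->
  1 - hs2 (adjm (colN u J) *m delta_mx a (0 : 'I_1)) <= eps.
Proof.
move=> ou hc; pose x : 'cV[C]_d := \col_j c j.
have hn N : sqnorm_part (vlin c u) N = hs2 (colN u N *m x).
  rewrite /hs2; under [RHS]eq_bigr do rewrite big_ord1.
  rewrite -[LHS]/(zsumN (fun k => \sum_i cabs (vlin c u k i) ^+ 2) N) -(sum_modes (fun k i => cabs (vlin c u k i) ^+ 2)).
  apply: eq_bigr => p _; congr (cabs _ ^+ 2); rewrite mxE; apply: eq_bigr => j _.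
  by rewrite !mxE mulrC.
have hN N : (J <= N)%N -> 1 + hs2 (colN u N *m x) -
    2 * complex.Re (vlin c u (mode a) (component a)) <= eps.
  move=> JN; apply: le_trans (hc N); rewrite -hn -[X in X + _ - _](sqnorm_stdbasis a JN).
  rewrite -(stdbasis_eval a (vlin c u) JN) raddf_sum mulr_sumr -big_split -sumrB.
  apply: ler_sum => k _ /=; rewrite raddf_sum mulr_sumr -big_split -sumrB.
  apply: ler_sum => i _ /=; rewrite !cabs_sqr.
  case: (e_ J a _ i) (vlin c u _ i) => x1 x2 [y1 y2] /=.
  by rewrite le_eqVlt; apply/orP; left; apply/eqP; ring.
(* The truncation to modes up to [N] disappears in the limit, by Parseval. *)
have hx : 1 + hs2 x - 2 * complex.Re (vlin c u (mode a) (component a)) <= eps.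
  apply/ler_addgt0Pr => del d0.
  have [M hM] := hs2_colN_cvg x ou d0.
  have := hM (maxn J M) (leq_maxr _ _); rewrite -rmorphB /= -[X in cabs X]/(cR _) cabs_cR.
  rewrite distrC => /(le_lt_trans (ler_norm _)).
  have := hN _ (leq_maxl J M); lra.
have := Re_tr_adjm_le (adjm (colN u J) *m delta_mx a 0) x.
have -> : \tr (adjm (adjm (colN u J) *m delta_mx a 0) *m x) =
    vlin c u (mode a) (component a).
  rewrite /mxtrace big_ord1 adjmM adjmK -mulmxA mxE (bigD1 a) //= big1 ?addr0.
    rewrite !mxE !eqxx conjc1 mul1r; apply: eq_bigr => j _.
    by rewrite !mxE mulrC.
  by move=> b ba; rewrite !mxE (negbTE ba) conjc0 mul0r.
lra.
Qed.

(** As [U] is contractive, [|e - U U^* e|^2 = 1 + |U U^* e|^2 - 2 |U^* e|^2 <= 1 - |U^* e|^2], and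
    the entry is one coordinate of this vector. *)
Lemma gram_section_defect d (u : 'I_d -> vec) J (a b : 'I_(dimH n J)) :
  Defs.orthonormal u ->
  cabs ((colN u J *m adjm (colN u J)) b a - (1%:M : 'M[C]_(dimH n J)) b a) ^+ 2 <=
  1 - hs2 (adjm (colN u J) *m delta_mx a (0 : 'I_1)).
Proof.
move=> ou; set U := colN u J; set e := delta_mx a 0.
have hU : contractive U := colN_contractive J ou.
have h1 : hs2 e = 1.
  rewrite /hs2 (bigD1 a) //= big_ord1 mxE !eqxx cabs1 expr1n big1 ?addr0 // => i ia.
  by rewrite big_ord1 mxE (negbTE ia) cabs0 expr0n.
have h2 : hs2 (e - U *m (adjm U *m e)) <= 1 - hs2 (adjm U *m e).
  rewrite hs2B h1.
  have -> : adjm e *m (U *m (adjm U *m e)) = adjm (adjm U *m e) *m (adjm U *m e).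
    by rewrite adjmM adjmK !mulmxA.
  by rewrite -hs2_Re_tr; have := hU _ (adjm U *m e); lra.
apply: le_trans h2; rewrite -hs2N opprB mulmxA.
rewrite /hs2 (bigD1 b) //= big_ord1.
have -> : (U *m adjm U *m e - e) b 0 =
    (U *m adjm U) b a - (1%:M : 'M[C]_(dimH n J)) b a.
  rewrite [LHS]mxE [X in _ + X]mxE [e b 0]mxE [1%:M b a]mxE eqxx andbT; congr (_ - _).
  rewrite [LHS]mxE (bigD1 a) //= [e a 0]mxE !eqxx mulr1 big1 ?addr0 // => i ia.
  by rewrite [e i 0]mxE (negbTE ia) mulr0.
by rewrite lerDl; do 2!apply: sumr_ge0 => ? _; exact: sqr_ge0.
Qed.

Lemma vlin_nested (dim : nat -> nat) (u : forall m, 'I_(dim m) -> vec) :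
  (forall m (j : 'I_(dim m)), exists c : 'I_(dim m.+1) -> C, u m j = vlin c (u m.+1)) ->
  forall m0 m (c : 'I_(dim m0) -> C), (m0 <= m)%N ->
  exists c' : 'I_(dim m) -> C, vlin c (u m0) = vlin c' (u m).
Proof.
move=> hn m0 m c /subnK <-; elim: (m - m0)%N => [|l [c' IH]]; first by exists c.
rewrite IH addSn.
have [f hf] := choice (hn (l + m0)%N).
exists (fun q => \sum_j c' j * f j q); apply/funext => k; apply/funext => i.
rewrite /vlin; under [RHS]eq_bigr do rewrite mulr_suml.
rewrite exchange_big /=; apply: eq_bigr => j _; rewrite hf /vlin mulr_sumr.
by apply: eq_bigr => q _; rewrite mulrA.
Qed.

Section Limit.
Variables (h : int -> int -> R) (B : R).
Hypothesis hB : forall N, sqsum h N <= B.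
Hypothesis h0 : forall k m, 0 <= h k m.

Lemma det2_stdbasis_close (eps : R) : 0 < eps -> exists J0, forall J, (J0 <= J)%N ->
  forall (K : kernel), dominated h K -> forall N, (J <= N)%N ->
  cabs (det2 (compress K (e_ N)) - det2 (matN K J)) <= eps.
Proof.
move=> e0; have [J0 hJ0] := @section_close R n h B hB eps h0 e0.
exists J0 => J J0J K hK N JN.
have := hJ0 J J0J K hK _ _ (stdbasis_orthonormal N).
by rewrite -mulmxA det2_mulC -mulmxA colN_stdbasis // mulmx1.
Qed.

(** Both compressions are close to [det2 (matN K J)]. Choosing [J0] before [K] is what gives
    uniformity over a family with a common majorant. *)
Lemma det2_stdbasis_cauchy (eps : R) : 0 < eps -> exists J0, forall J, (J0 <= J)%N ->
  forall (K : kernel), dominated h K -> forall N, (J <= N)%N ->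
  cabs (det2 (compress K (e_ N)) - det2 (compress K (e_ J))) <= eps.
Proof.
move=> e0; have e20 : 0 < eps / 2 by rewrite divr_gt0.
have [J0 hJ0] := det2_stdbasis_close e20; exists J0 => J J0J K hK N JN.
have h1 := hJ0 J J0J K hK N JN; have h2 := hJ0 J J0J K hK J (leqnn J).
set x := det2 (compress K (e_ N)) in h1 *; set y := det2 (compress K (e_ J)) in h2 *.
have -> : x - y = (x - det2 (matN K J)) - (y - det2 (matN K J)) by ring.
by rewrite (le_trans (cabsD _ _)) // cabsN (splitr eps) lerD.
Qed.

Lemma det2_stdbasis_cvg (K : kernel) : dominated h K ->
  exists s, cconv (fun J => det2 (compress K (e_ J))) s.
Proof.
move=> hK; apply: cconv_cauchy => eps e0.
have e20 : 0 < eps / 2 by rewrite divr_gt0.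
have [J0 hJ0] := det2_stdbasis_cauchy e20; exists J0 => N JN.
apply: le_lt_trans (hJ0 J0 (leqnn _) K hK N JN) _.
by rewrite ltr_pdivrMr // ltr_pMr // ltr1n.
Qed.

Lemma gram_section_cvg (dim : nat -> nat) (u : forall m, 'I_(dim m) -> vec) J :
  (forall m, Defs.orthonormal (u m)) ->
  (forall m (j : 'I_(dim m)), exists c : 'I_(dim m.+1) -> C, u m j = vlin c (u m.+1)) ->
  (forall v, l2 v -> forall eps : R, 0 < eps -> exists m (c : 'I_(dim m) -> C),
      forall N, sqnorm_part (fun k i => v k i - vlin c (u m) k i) N <= eps) ->
  forall a b, cconv (fun m => (colN (u m) J *m adjm (colN (u m) J)) a b)
                    ((1%:M : 'M[C]_(dimH n J)) a b).
Proof.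
move=> ou hn hd a b eps e0.
have e20 : 0 < (eps / 2) ^+ 2 by rewrite exprn_gt0 // divr_gt0.
have [m0 [c hc]] := hd _ ((stdbasis_orthonormal J).1 b) _ e20.
(* Nestedness carries the approximant found at level [m0] to every later level. *)
exists m0 => m m0m; have [c' hc'] := vlin_nested hn c m0m.
rewrite hc' in hc.
have h1 := le_trans (gram_section_defect b a (ou m)) (density_stdbasis (ou m) hc).
have h2 : cabs ((colN (u m) J *m adjm (colN (u m) J)) a b -
   (1%:M : 'M[C]_(dimH n J)) a b) <= eps / 2.
  by rewrite -(@ler_pXn2r _ 2) ?nnegrE ?cabs_ge0 // ltW // divr_gt0.
by apply: le_lt_trans h2 _; rewrite ltr_pdivrMr // ltr_pMr // ltr1n.
Qed.

(** With [J] fixed first and [U = colN (u m) J], the determinant along [u] is near that of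
    [matN K J *m (U *m adjm U)]; this tends to [det2 (matN K J)] as [m] grows, which is near [s]. *)
Lemma IsDet2_limit (K : kernel) s : dominated h K ->
  cconv (fun J => det2 (compress K (e_ J))) s -> IsDet2 K s.
Proof.
move=> hK hs dim u ou hn hd eps e0.
have e40 : 0 < eps / 4 by rewrite divr_gt0.
have [J1 h1] := @section_close R n h B hB _ h0 e40.
have [J2 h2] := det2_stdbasis_close e40.
pose J := maxn J1 J2.
have hsJ : cabs (s - det2 (matN K J)) <= eps / 4.
  by apply: (cconv_close hs (N := J)) => N JN; apply: h2 => //; exact: leq_maxr.
have hG : cconv (fun m => det2 (matN K J *m (colN (u m) J *m adjm (colN (u m) J))))
                (det2 (matN K J)).
  rewrite -[X in det2 X]mulmx1.
  by apply: det2_cconv; apply: cconv_mulmxl; apply: gram_section_cvg.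
have [M hM] := hG _ e40; exists M => m /hM {}hM.
have := h1 J (leq_maxl _ _) K hK _ _ (ou m).
rewrite -mulmxA det2_mulC -mulmxA.
set x := det2 (compress K (u m)); set y := det2 (_ *m _) in hM * => hx.
have -> : x - s = (x - y) + (y - det2 (matN K J)) - (s - det2 (matN K J)) by ring.
apply: le_lt_trans (cabsD _ _) _; rewrite cabsN.
apply: le_lt_trans (lerD (cabsD _ _) (lexx _)) _; lra.
Qed.

End Limit.
End StandardBasis.

(** * Bessel's inequality for Fourier coefficients *)

Section Bessel.
Import numFieldNormedType.Exports.
Local Open Scope classical_set_scope.
Variables (R : realType) (X : R).
Hypothesis X0 : 0 < X.
Local Notation mu := (@lebesgue_measure R).
Local Notation D := (`[0, X]%classic : set R).
Local Notation I := (Rint01 X).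
(* [lebesgue_measure] lives on the alias [measurableTypeR R], whose display differs
   from the default one of [R]; the two notions of measurability are convertible. *)
Local Notation mfunD f := (@measurable_fun _ _ (measurableTypeR R) R D f).

Definition integ (f : R -> R) := mu.-integrable D (EFin \o f).
Definition angle (l : int) (x : R) : R := 2 * pi * l%:~R * x / X.

Let mD : measurable (D : set (measurableTypeR R)). Proof. exact: measurable_itv. Qed.

Lemma integD f g : integ f -> integ g -> integ (fun x => f x + g x).
Proof. by move=> hf hg; exact: (integrableD mD hf hg). Qed.

Lemma integZ c f : integ f -> integ (fun x => c * f x).
Proof. by move=> hf; exact: (integrableZl mD c hf). Qed.

Lemma IZ c f : integ f -> I (fun x => c * f x) = c * I f.
Proof. by move=> hf; exact: RintegralZl. Qed.

Lemma ID f g : integ f -> integ g -> I (fun x => f x + g x) = I f + I g.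
Proof. by move=> hf hg; exact: RintegralD. Qed.

Lemma I_lin3 a b f g h : integ f -> integ g -> integ h ->
  I (fun x => f x + a * g x + b * h x) = I f + a * I g + b * I h.
Proof.
move=> hf hg hh; rewrite ID; [|by apply: integD => //; apply: integZ|exact: integZ].
by rewrite ID //; [rewrite !IZ|exact: integZ].
Qed.

Lemma mu_D : mu D = X%:E.
Proof. by rewrite lebesgue_measure_itv /= lte_fin X0 oppr0 adde0. Qed.

Lemma I_cst c : I (fun=> c) = c * X.
Proof. by rewrite /Rint01 Rintegral_cst //; congr (_ * _); exact: (congr1 fine mu_D). Qed.

Lemma integ_cst c : integ (fun=> c).
Proof.
apply: measurable_bounded_integrable => //.
- by rewrite [X in (X < _)%E](_ : _ = X%:E) ?ltey //; exact: mu_D.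
- by exists `|c|; split; [exact: num_real | move=> y /ltW cy x _].
Qed.

Lemma continuous_angle l : continuous (angle l).
Proof. by move=> x; apply: cvgMl; apply: cvgMr; exact: cvg_id. Qed.

Lemma continuous_cos_angle l : continuous (fun x => cos (angle l x)).
Proof. by move=> x; apply: continuous_comp; [exact: continuous_angle|exact: continuous_cos]. Qed.

Lemma continuous_sin_angle l : continuous (fun x => sin (angle l x)).
Proof. by move=> x; apply: continuous_comp; [exact: continuous_angle|exact: continuous_sin]. Qed.

Lemma measurable_cos_angle l : mfunD (fun x => cos (angle l x)).
Proof.
by apply: measurable_funTS; apply: continuous_measurable_fun; exact: continuous_cos_angle.
Qed.

Lemma measurable_sin_angle l : mfunD (fun x => sin (angle l x)).
Proof.
by apply: measurable_funTS; apply: continuous_measurable_fun; exact: continuous_sin_angle.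
Qed.

(** [f] and [g] are the real and imaginary parts of one complex function. *)
Definition squareInt (f g : R -> R) := [/\ mfunD f, mfunD g &
  integ (fun x => f x ^+ 2 + g x ^+ 2)].

Lemma le_integ f g h : squareInt f g -> mfunD h ->
  (forall x, `|h x| <= 1 + (f x ^+ 2 + g x ^+ 2)) -> integ h.
Proof.
move=> [mf mg fg] mh hle; rewrite /integ.
apply: (le_integrable mD (g :=
   EFin \o (fun x => 1 + (f x ^+ 2 + g x ^+ 2)))); first last.
- by apply: integD => //; exact: integ_cst.
- by move=> x _ /=; rewrite lee_fin (le_trans (hle x)) // ler_norm.
- exact/measurable_EFinP.
Qed.

Lemma angleB l m x : angle l x - angle m x = angle (l - m) x.
Proof. by rewrite /angle rmorphB /=; ring. Qed.

Lemma trig_combination_le (a b t : R) :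
  `|a * cos t + b * sin t| <= 1 + (a ^+ 2 + b ^+ 2).
Proof.
have := cos2Dsin2 t; rewrite ler_norml; set c := cos t; set s := sin t => cs.
have := sqr_ge0 (a - c); have := sqr_ge0 (b - s).
have := sqr_ge0 (a + c); have := sqr_ge0 (b + s) => h1 h2 h3 h4.
by apply/andP; split; nra.
Qed.

Lemma integ_Re f g l : squareInt f g ->
  integ (fun x => f x * cos (angle l x) + g x * sin (angle l x)).
Proof.
move=> fg; have [mf mg _] := fg; apply: (le_integ fg) => [|x].
  apply: measurable_funD; apply: measurable_funM => //.
    exact: measurable_cos_angle.
  exact: measurable_sin_angle.
exact: trig_combination_le.
Qed.

Lemma integ_Im f g l : squareInt f g ->
  integ (fun x => g x * cos (angle l x) - f x * sin (angle l x)).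
Proof.
move=> fg; have [mf mg _] := fg; apply: (le_integ fg) => [|x].
  apply: measurable_funB; apply: measurable_funM => //.
    exact: measurable_cos_angle.
  exact: measurable_sin_angle.
by have := trig_combination_le (g x) (- f x) (angle l x); rewrite mulNr sqrrN [g x ^+ 2 + _]addrC.
Qed.

Lemma squareInt_cst c d : squareInt (fun=> c) (fun=> d).
Proof. by split; [exact: measurable_cst|exact: measurable_cst|exact: integ_cst]. Qed.

Lemma integ_cos l : integ (fun x => cos (angle l x)).
Proof.
rewrite (_ : (fun x => _) = (fun x => 1 * cos (angle l x) + 0 * sin (angle l x))).
  exact: integ_Re (squareInt_cst 1 0).
by apply/funext => x; rewrite mul1r mul0r addr0.
Qed.

Lemma integ_sin l : integ (fun x => sin (angle l x)).
Proof.
rewrite (_ : (fun x => _) = (fun x => 0 * cos (angle l x) + 1 * sin (angle l x))).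
  exact: integ_Re (squareInt_cst 0 1).
by apply/funext => x; rewrite mul1r mul0r add0r.
Qed.

Lemma angle0 l : angle l 0 = 0. Proof. by rewrite /angle mulr0 mul0r. Qed.

Lemma angleX l : angle l X = (pi *+ 2) *~ l.
Proof.
rewrite /angle mulfK ?gt_eqF //.
by rewrite -[RHS]mulrzr -[pi *+ 2]mulr_natl.
Qed.

Lemma sin_angleX l : sin (angle l X) = 0.
Proof.
rewrite angleX; case: l => k.
  by rewrite -pmulrn -[_ *+ k]add0r periodicn ?sin0 //; exact: sinD2pi.
rewrite NegzE mulrNz -pmulrn sinN -[_ *+ k.+1]add0r periodicn ?sin0 ?oppr0 //; exact: sinD2pi.
Qed.

Lemma cos_angleX l : cos (angle l X) = 1.
Proof.
rewrite angleX; case: l => k.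
  by rewrite -pmulrn -[_ *+ k]add0r periodicn ?cos0 //; exact: cosD2pi.
rewrite NegzE mulrNz -pmulrn cosN -[_ *+ k.+1]add0r periodicn ?cos0 //; exact: cosD2pi.
Qed.

Lemma I_FTC (f F : R -> R) : continuous f -> (forall x : R, is_derive x 1 F (f x)) ->
  I f = F X - F 0.
Proof.
move=> cf dF; have cF : continuous F.
  by move=> x; apply: differentiable_continuous; apply/derivable1_diffP; case: (dF x).
rewrite /Rint01 /Rintegral (@continuous_FTC2 _ f F) //.
- exact: continuous_subspaceT.
- split; first by move=> x _; case: (dF x).
  + by apply: cvg_at_right_filter; exact: cF.
  + by apply: cvg_at_left_filter; exact: cF.
- by move=> x _; rewrite derive1E; exact: derive_val.
Qed.

Lemma I_cos l : I (fun x => cos (angle l x)) = if l == 0 then X else 0.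
Proof.
case: eqP => [->|/eqP l0].
  rewrite -[RHS]mul1r -I_cst; congr (I _); apply/funext => x.
  by rewrite /angle mulr0 !mul0r cos0.
have w0 : 2 * pi * l%:~R / X != 0 :> R.
  by rewrite !mulf_neq0 ?invr_eq0 ?intr_eq0 ?pnatr_eq0 // lt0r_neq0 ?pi_gt0.
pose w := 2 * pi * l%:~R / X.
have aE : angle l = fun x => w * x by apply/funext => x; rewrite /angle /w; ring.
have dF (x : R) : is_derive x 1 (fun x => w^-1 * sin (angle l x)) (cos (angle l x)).
  by rewrite aE; apply: is_derive_eq; rewrite /GRing.scale /= -/w; field; exact: w0.
rewrite (I_FTC (@continuous_cos_angle l) dF).
by rewrite sin_angleX angle0 sin0 subrr.
Qed.

Lemma I_sin l : I (fun x => sin (angle l x)) = 0.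
Proof.
have [->|l0] := eqVneq l 0.
  rewrite -[RHS](mul0r X) -I_cst; congr (I _); apply/funext => x.
  by rewrite /angle mulr0 !mul0r sin0.
have w0 : 2 * pi * l%:~R / X != 0 :> R.
  by rewrite !mulf_neq0 ?invr_eq0 ?intr_eq0 ?pnatr_eq0 // lt0r_neq0 ?pi_gt0.
pose w := 2 * pi * l%:~R / X.
have aE : angle l = fun x => w * x by apply/funext => x; rewrite /angle /w; ring.
have dF (x : R) : is_derive x 1 (fun x => - (w^-1 * cos (angle l x))) (sin (angle l x)).
  by rewrite aE; apply: is_derive_eq; rewrite /GRing.scale /= -/w; field; exact: w0.
rewrite (I_FTC (@continuous_sin_angle l) dF).
by rewrite cos_angleX angle0 cos0 subrr.
Qed.

(** Real part, and below imaginary part, of the [l]-th Fourier coefficient of [f + i g]. *)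
Definition coefRe (f g : R -> R) l :=
  X^-1 * I (fun x => f x * cos (angle l x) + g x * sin (angle l x)).
Definition coefIm (f g : R -> R) l :=
  X^-1 * I (fun x => g x * cos (angle l x) - f x * sin (angle l x)).

(* Subtracting one mode at a time lets Bessel's inequality go by induction on the
   list of modes, without ever integrating a finite sum. *)
Section RemoveMode.
Variables (f g : R -> R) (l : int).
Hypothesis fg : squareInt f g.
Let c := coefRe f g l.
Let d := coefIm f g l.
Let f' x := f x - (c * cos (angle l x) - d * sin (angle l x)).
Let g' x := g x - (c * sin (angle l x) + d * cos (angle l x)).

Let sq' : (fun x => f' x ^+ 2 + g' x ^+ 2) = (fun x => (f x ^+ 2 + g x ^+ 2)
  + (- (2 * c)) * (f x * cos (angle l x) + g x * sin (angle l x))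
  + (- (2 * d)) * (g x * cos (angle l x) - f x * sin (angle l x)) + (c ^+ 2 + d ^+ 2)).
Proof.
apply/funext => x; rewrite /f' /g'; have := cos2Dsin2 (angle l x).
set C := cos _; set S := sin _ => CS.
have -> : c ^+ 2 + d ^+ 2 = (c ^+ 2 + d ^+ 2) * (C ^+ 2 + S ^+ 2) by rewrite CS mulr1.
ring.
Qed.

Lemma squareInt_removeMode : squareInt f' g'.
Proof.
have [mf mg ifg] := fg.
have mc := measurable_cos_angle l; have ms := measurable_sin_angle l.
split.
- by apply: measurable_funB => //; apply: measurable_funB; apply: measurable_funM.
- by apply: measurable_funB => //; apply: measurable_funD; apply: measurable_funM.
rewrite sq'; apply: integD; last exact: integ_cst.
apply: integD; last by apply: integZ; exact: integ_Im.
by apply: integD => //; apply: integZ; exact: integ_Re.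
Qed.

(** The cross terms contribute [- 2 * (c ^+ 2 + d ^+ 2)], and the energy of the removed mode adds
    one copy back. *)
Lemma energy_removeMode : X^-1 * I (fun x => f' x ^+ 2 + g' x ^+ 2) =
  X^-1 * I (fun x => f x ^+ 2 + g x ^+ 2) - (c ^+ 2 + d ^+ 2).
Proof.
have [mf mg ifg] := fg.
have i1 := integ_Re l fg; have i2 := integ_Im l fg.
rewrite sq' ID; [|by apply: integD; [apply: integD => //; apply: integZ|apply: integZ]|exact: integ_cst].
rewrite I_lin3 // I_cst !mulrDr.
rewrite ![X^-1 * (- _ * _)]mulrCA -/(coefRe f g l) -/(coefIm f g l) -/c -/d.
have XX : X^-1 * X = 1 by rewrite mulVf ?gt_eqF.
rewrite [X^-1 * (_ * X)]mulrCA XX; ring.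
Qed.

(** Orthogonality of modes: the removed one contributes integrals of [cos] and [sin] of
    [angle (l - m)], which vanish. *)
Lemma coefRe_removeMode m : m != l -> coefRe f' g' m = coefRe f g m.
Proof.
move=> ml; rewrite /coefRe; congr (_ * _).
have -> : (fun x => f' x * cos (angle m x) + g' x * sin (angle m x)) =
  (fun x => f x * cos (angle m x) + g x * sin (angle m x)
     + (- c) * cos (angle (l - m) x) + d * sin (angle (l - m) x)).
  apply/funext => x; rewrite -!angleB cosB sinB /f' /g'; ring.
rewrite I_lin3; [|exact: integ_Re|exact: integ_cos|exact: integ_sin].
by rewrite I_cos I_sin subr_eq0 eq_sym (negbTE ml) !mulr0 !addr0.
Qed.

Lemma coefIm_removeMode m : m != l -> coefIm f' g' m = coefIm f g m.
Proof.
move=> ml; rewrite /coefIm; congr (_ * _).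
have -> : (fun x => g' x * cos (angle m x) - f' x * sin (angle m x)) =
  (fun x => g x * cos (angle m x) - f x * sin (angle m x)
     + (- d) * cos (angle (l - m) x) + (- c) * sin (angle (l - m) x)).
  apply/funext => x; rewrite -!angleB cosB sinB /f' /g'; ring.
rewrite I_lin3; [|exact: integ_Im|exact: integ_cos|exact: integ_sin].
by rewrite I_cos I_sin subr_eq0 eq_sym (negbTE ml) !mulr0 !addr0.
Qed.

End RemoveMode.

(** Removing mode [l] lowers the energy by its squared coefficient and leaves the other coefficients
    alone, so the induction hypothesis applies to the remainder. *)
Lemma bessel (s : seq int) f g : uniq s -> squareInt f g ->
  \sum_(l <- s) (coefRe f g l ^+ 2 + coefIm f g l ^+ 2) <=
  X^-1 * I (fun x => f x ^+ 2 + g x ^+ 2).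
Proof.
elim: s f g => [|l s IH] f g.
  move=> _ _; rewrite big_nil mulr_ge0 ?invr_ge0 ?(ltW X0) //.
  by apply: Rintegral_ge0 => x _; rewrite addr_ge0 ?sqr_ge0.
rewrite cons_uniq big_cons => /andP[ls us] fg.
have := IH _ _ us (squareInt_removeMode l fg).
rewrite (energy_removeMode l fg) lerBrDl; apply: le_trans.
rewrite lerD2l le_eqVlt; apply/orP; left; apply/eqP.
rewrite !big_seq; apply: eq_bigr => m ms.
have ml : m != l by apply: contra ls => /eqP <-.
by rewrite coefRe_removeMode // coefIm_removeMode.
Qed.

End Bessel.

(** * Hilbert-Schmidt bound for the kernel *)

Section Domination.
Variables (R : realType) (X : R) (n : nat).
Hypothesis X0 : 0 < X.
Local Notation C := (complex R).

Definition fcoef2 (a : R -> 'M[C]_n) (l : int) : R :=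
  \sum_p \sum_q cabs (fcoef X a l p q) ^+ 2.

Lemma fcoef2_ge0 a l : 0 <= fcoef2 a l.
Proof. by do 2!apply: sumr_ge0 => ? _; exact: sqr_ge0. Qed.

Lemma le_fcoef2 a l p q : cabs (fcoef X a l p q) ^+ 2 <= fcoef2 a l.
Proof.
rewrite /fcoef2 (bigD1 p) //= (bigD1 q) //= -addrA lerDl addr_ge0 //.
  by apply: sumr_ge0 => ? _; exact: sqr_ge0.
by do 2!apply: sumr_ge0 => ? _; exact: sqr_ge0.
Qed.

(** Bessel's inequality entry by entry. Bounding sums over duplicate-free lists lets the bound
    survive the shift [l = k - m]. *)
Lemma fcoef2_summable a : L2per X a -> exists B : R, forall s : seq int, uniq s ->
  \sum_(l <- s) fcoef2 a l <= B.
Proof.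
move=> [_ ha].
pose E p q := X^-1 * Rint01 X (fun x => complex.Re (a x p q) ^+ 2 + complex.Im (a x p q) ^+ 2).
exists (\sum_p \sum_q E p q) => s us.
rewrite /fcoef2 exchange_big; apply: ler_sum => p _ /=.
rewrite exchange_big; apply: ler_sum => q _ /=.
have [mr [mi ii]] := ha p q.
have sI : squareInt X (fun x => complex.Re (a x p q)) (fun x => complex.Im (a x p q)) by [].
apply: le_trans (bessel X0 us sI).
rewrite le_eqVlt; apply/orP; left; apply/eqP; apply: eq_bigr => l _.
by rewrite cabs_sqr !mxE.
Qed.

(** Common majorant of the squared moduli of [mult0] and [mult1]. *)
Definition symbol (k : int) : R := (1 + xi X k ^+ 2)^-1.

Lemma symbol_ge0 k : 0 <= symbol k.
Proof. by rewrite invr_ge0 addr_ge0 ?sqr_ge0. Qed.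

Lemma symbol_summable : exists B, forall N, zsumN symbol N <= B.
Proof.
pose A : R := (X / (2 * pi)) ^+ 2.
have A0 : 0 <= A by exact: sqr_ge0.
have pi0 : pi != 0 :> R by rewrite gt_eqF // pi_gt0.
have hs (N : nat) (k : int) : k ^+ 2 = (N.+1%:Z) ^+ 2 -> symbol k <= A / N.+1%:R ^+ 2.
  move=> kN; rewrite /symbol /A.
  have kR : (k%:~R : R) ^+ 2 = N.+1%:R ^+ 2 by rewrite -rmorphXn /= kN rmorphXn.
  have xk : xi X k ^+ 2 = N.+1%:R ^+ 2 / (X / (2 * pi)) ^+ 2.
    rewrite /xi -kR; move: (pi : R) pi0 => p p0; field.
    by rewrite p0 gt_eqF.
  have p0 : 0 < (X / (2 * pi)) ^+ 2 :> R by rewrite exprn_gt0 // divr_gt0 // mulr_gt0 // pi_gt0.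
  have n0 : 0 < N.+1%:R ^+ 2 :> R by rewrite exprn_gt0.
  rewrite xk -[leRHS]invf_div lef_pV2 ?posrE ?divr_gt0 //; first by rewrite lerDr.
  by rewrite ltr_wpDr // divr_ge0 // ltW.
exists (1 + 4 * A) => N.
(* Telescoping claim: passing from [N] to [N + 1] adds at most [2 A / (N + 1)^2], and
   [N + 2 <= 2 (N + 1)] bounds this by the increment [4 A / ((N + 1) (N + 2))]. *)
suff: zsumN symbol N <= 1 + 4 * A * (1 - N.+1%:R^-1).
  move/le_trans; apply; have : 0 <= N.+1%:R^-1 :> R by rewrite invr_ge0.
  set t := _^-1; nra.
elim: N => [|N IH].
  have -> : zsumN symbol 0 = symbol 0 by rewrite /zsumN big_ord1.
  by rewrite invr1 subrr mulr0 addr0 /symbol /xi mulr0 mul0r expr0n addr0 invr1.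
rewrite zsumNS.
have h1 := @hs N (- N.+1%:Z) (sqrrN _); have h2 := hs N N.+1%:Z erefl.
apply: le_trans (lerD IH (lerD h1 h2)) _.
rewrite -subr_ge0.
have -> : N.+1%:R = N%:R + 1 :> R by rewrite natr1.
have -> : N.+2%:R = N%:R + 2 :> R by rewrite -natrD addn2.
move: (N%:R : R) (ler0n R N) => t t0.
have -> : 1 + 4 * A * (1 - (t + 2)^-1) - (1 + 4 * A * (1 - (t + 1)^-1) +
    (A / (t + 1) ^+ 2 + A / (t + 1) ^+ 2)) =
    2 * A * t / ((t + 1) ^+ 2 * (t + 2)).
  by field; apply/andP; split; apply: lt0r_neq0; lra.
apply: divr_ge0; first by rewrite mulr_ge0 // mulr_ge0.
by rewrite mulr_ge0 ?exprn_ge0 // addr_ge0.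
Qed.

Lemma shifted_sum_le (b : int -> R) B : (forall s : seq int, uniq s -> \sum_(l <- s) b l <= B) ->
  forall k N, zsumN (fun m => b (k - m)) N <= B.
Proof.
move=> hb k N.
pose g (m : 'I_(N + N).+1) : int := k - (m%:Z - N%:Z).
have -> : zsumN (fun m => b (k - m)) N = \sum_(l <- [seq g m | m <- enum 'I_(N + N).+1]) b l.
  by rewrite big_map big_enum.
apply: hb; rewrite map_inj_uniq ?enum_uniq // => x y; rewrite /g => h.
by apply: val_inj => /=; move: h; lia.
Qed.

Lemma cabs_mult1 k : cabs (mult1 X k) ^+ 2 <= symbol k.
Proof.
rewrite /mult1 /symbol; move: (xi X k) => x; have x0 := sqr_ge0 x.
rewrite !cabsM cabsV !cabs_cR !exprMn exprVn !real_normK ?num_real //.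
rewrite cabs_ci.
rewrite expr1n mul1r.
have -> : (- x ^+ 2 - 1) ^+ 2 = (1 + x ^+ 2) ^+ 2 by ring.
have p0 : 0 < 1 + x ^+ 2 by lra.
rewrite ler_pdivrMr ?exprn_gt0 // expr2 mulrA mulVf ?gt_eqF // mul1r; lra.
Qed.

Lemma cabs_mult0 k : cabs (mult0 X k) ^+ 2 <= symbol k.
Proof.
rewrite /mult0 /symbol; move: (xi X k) => x; have x0 := sqr_ge0 x.
rewrite !cabsV !cabs_cR !exprVn !real_normK ?num_real //.
have -> : (- x ^+ 2 - 1) ^+ 2 = (1 + x ^+ 2) ^+ 2 by ring.
have p0 : 0 < 1 + x ^+ 2 by lra.
by rewrite lef_pV2 ?posrE ?exprn_gt0 //; move: (x ^+ 2) x0 => y y0; nra.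
Qed.

Variables (a0 a1 : R -> 'M[C]_n).

(** [s] bounds [sigma] and [L] bounds [|lambda|]. The [3] comes from squaring a sum of three terms,
    and the last summand carries the multiples of the identity in [A_1] and
    [A_0 + (1 - lambda) I]. *)
Definition Kop_bound (s L : R) (k m : int) : R :=
  3 * (1 + L + 2 * s + s ^+ 2) ^+ 2 *
  (symbol k * (fcoef2 a1 (k - m) + fcoef2 a0 (k - m) + (k - m == 0)%:R)).

Lemma Kop_bound_ge0 s L k m : 0 <= Kop_bound s L k m.
Proof.
apply: mulr_ge0; first by rewrite mulr_ge0 ?sqr_ge0.
apply: mulr_ge0; first exact: symbol_ge0.
by apply: addr_ge0 => //; apply: addr_ge0; exact: fcoef2_ge0.
Qed.

Lemma Kop_bound_summable s L : L2per X a0 -> L2per X a1 ->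
  exists B, forall N, sqsum (Kop_bound s L) N <= B.
Proof.
move=> h0 h1.
have [B0 hB0] := fcoef2_summable h0; have [B1 hB1] := fcoef2_summable h1.
have [S hS] := symbol_summable.
have hd (r : seq int) : uniq r -> \sum_(l <- r) ((l == 0)%:R : R) <= 1.
  move=> ur; have [i0|i0] := boolP (0 \in r).
    by rewrite (bigD1_seq 0) //= big1 ?addr0 // => i /negbTE ->.
  rewrite big_seq big1 ?ler01 // => i ir; case: eqP => // e.
  by rewrite -e ir in i0.
have hb (r : seq int) : uniq r ->
    \sum_(l <- r) (fcoef2 a1 l + fcoef2 a0 l + (l == 0)%:R) <= B1 + B0 + 1.
  by move=> ur; rewrite !big_split /= !lerD // ?hB1 ?hB0 ?hd.
set T := 3 * (1 + L + 2 * s + s ^+ 2) ^+ 2.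
have T0 : 0 <= T by rewrite mulr_ge0 ?sqr_ge0.
have b0 : 0 <= B1 + B0 + 1 by apply: le_trans (hb [::] isT); rewrite big_nil.
exists (T * (S * (B1 + B0 + 1))) => N.
apply: (@le_trans _ _ (T * (zsumN symbol N * (B1 + B0 + 1)))); last first.
  by rewrite ler_wpM2l // ler_wpM2r.
rewrite /sqsum {1 3}/zsumN mulr_suml mulr_sumr; apply: ler_sum => k _.
rewrite /Kop_bound -/T {1}/zsumN -!mulr_sumr ler_wpM2l // ler_wpM2l ?symbol_ge0 //.
exact: (shifted_sum_le hb).
Qed.

Lemma Kop_dominated s L sigma lambda : 0 <= sigma <= s -> cabs lambda <= L ->
  dominated (Kop_bound s L) (Kop X a0 a1 sigma lambda).
Proof.
move=> /andP[s0 ss] lL k i m j; rewrite /Kop /Kop_bound.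
set r := Num.sqrt (symbol k).
have r0 : 0 <= r by exact: sqrtr_ge0.
have rr : r ^+ 2 = symbol k by rewrite sqr_sqrtr // symbol_ge0.
have m1 : cabs (mult1 X k) <= r.
  by rewrite -(@ler_pXn2r _ 2) ?nnegrE ?cabs_ge0 // rr cabs_mult1.
have m0 : cabs (mult0 X k) <= r.
  by rewrite -(@ler_pXn2r _ 2) ?nnegrE ?cabs_ge0 // rr cabs_mult0.
set l := k - m; pose dl : R := (l == 0)%:R.
have dl0 : 0 <= dl by exact: ler0n.
set x1 := cabs (fcoef X a1 l i j); set x0 := cabs (fcoef X a0 l i j).
have x10 : 0 <= x1 := cabs_ge0 _; have x00 : 0 <= x0 := cabs_ge0 _.
have L0 := le_trans (cabs_ge0 _) lL.
have cabs_delta (z : C) : cabs (((l == 0)%:R * z) *+ (i == j)) <= dl * cabs z.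
  case: (i == j); rewrite ?mulr1n ?mulr0n ?cabs0 ?mulr_ge0 ?cabs_ge0 //.
  by rewrite cabsM cabs_nat.
have hA1 : cabs (A1hat X a1 sigma l i j) <= x1 + dl * (2 * s).
  rewrite /A1hat mxE [X in cabs (_ + X)]mxE (le_trans (cabsD _ _)) // lerD2l.
  apply: le_trans (cabs_delta _) _; rewrite ler_wpM2l // cabsM cabs_ci mul1r cabs_cR.
  by rewrite ger0_norm ?mulr_ge0 // ler_pM2l.
have hA0 : cabs (A0hat X a0 a1 sigma l i j) <= x0 + dl * s ^+ 2 + s * x1.
  rewrite /A0hat mxE [X in cabs (X + _)]mxE [X in cabs (_ + X + _)]mxE
    [X in cabs (_ + X)]mxE.
  rewrite (le_trans (cabsD _ _)) // lerD //.
    rewrite (le_trans (cabsD _ _)) // lerD2l (le_trans (cabs_delta _)) //.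
    rewrite ler_wpM2l // cabs_cR normrN ger0_norm ?sqr_ge0 //.
    by rewrite lerXn2r // nnegrE (le_trans s0).
  by rewrite !cabsM cabs_ci mul1r cabs_cR ger0_norm // ler_wpM2r.
have hl : cabs ((1 - lambda) * ((k == m) && (i == j))%:R) <= dl * (1 + L).
  rewrite cabsM cabs_nat mulrC /dl /l subr_eq0.
  case: (k == m) => /=; last by rewrite !mul0r.
  rewrite mul1r; apply: (@le_trans _ _ (cabs (1 - lambda))).
    by rewrite ler_piMl ?cabs_ge0 //; case: (i == j).
  by rewrite (le_trans (cabsD _ _)) // cabs1 cabsN lerD2l.
set T := 1 + L + 2 * s + s ^+ 2.
have s'0 := le_trans s0 ss.
(* [T] dominates all three coefficients: [1 + s] for [x1], [1] for [x0], and exactly [T] for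
   [dl]. *)
have hK : cabs (mult1 X k * A1hat X a1 sigma l i j + mult0 X k *
    (A0hat X a0 a1 sigma l i j + (1 - lambda) * ((k == m) && (i == j))%:R)) <=
    r * (T * (x1 + x0 + dl)).
  apply: le_trans (cabsD _ _) _; rewrite (cabsM (mult1 X k)) (cabsM (mult0 X k)).
  apply: (@le_trans _ _ (r * (x1 + dl * (2 * s)) +
     r * (x0 + dl * s ^+ 2 + s * x1 + dl * (1 + L)))).
    apply: lerD; apply: ler_pM; rewrite ?cabs_ge0 //.
    by apply: le_trans (cabsD _ _) _; rewrite lerD.
  rewrite -mulrDr ler_wpM2l // -subr_ge0.
  have -> : T * (x1 + x0 + dl) - (x1 + dl * (2 * s) +
     (x0 + dl * s ^+ 2 + s * x1 + dl * (1 + L))) =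
     x1 * (L + s + s ^+ 2) + x0 * (L + 2 * s + s ^+ 2) by rewrite /T; ring.
  by rewrite addr_ge0 ?mulr_ge0 ?addr_ge0 ?mulr_ge0 ?sqr_ge0.
apply: (@le_trans _ _ ((r * (T * (x1 + x0 + dl))) ^+ 2)).
  by rewrite lerXn2r ?nnegrE ?cabs_ge0 // (le_trans (cabs_ge0 _) hK).
rewrite 2!exprMn rr.
(* [dl] is zero or one, so its square may enter the majorant linearly. *)
have d2 : dl ^+ 2 = dl by rewrite /dl; case: (l == 0); rewrite ?expr0n ?expr1n.
have f1 : x1 ^+ 2 <= fcoef2 a1 l by exact: le_fcoef2.
have f0 : x0 ^+ 2 <= fcoef2 a0 l by exact: le_fcoef2.
have key : (x1 + x0 + dl) ^+ 2 <= 3 * (fcoef2 a1 l + fcoef2 a0 l + dl).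
  have := sqr_ge0 (x1 - x0); have := sqr_ge0 (x1 - dl); have := sqr_ge0 (x0 - dl).
  nra.
have := ler_wpM2l (mulr_ge0 (sqr_ge0 T) (symbol_ge0 k)) key.
rewrite -/l -/dl; move: (fcoef2 a1 l + fcoef2 a0 l + dl) => Y.
move: (T ^+ 2) (symbol k) ((x1 + x0 + dl) ^+ 2) => T2 S2 Z2; nra.
Qed.

End Domination.

(** * Uniform convergence of the truncated determinants *)

Theorem theorem3p8 (R : realType) (X : R) (n : nat)
    (a0 a1 : R -> 'M[complex R]_n) :
  0 < X -> (0 < n)%N -> L2per X a0 -> L2per X a1 ->
  exists D : R -> complex R -> complex R,
    (* D sigma lambda = det_2(I + K(sigma,lambda)) *)
    (forall sigma : R, 0 <= sigma < 2 * pi ->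
       forall lambda : complex R, IsDet2 (Kop X a0 a1 sigma lambda) (D sigma lambda)) /\
    (* D_{sigma,J} -> D_sigma uniformly in sigma in [0,2pi), locally uniformly in lambda *)
    (forall lambda0 : complex R, exists delta : R, 0 < delta /\
       forall eps : R, 0 < eps -> exists J0 : nat, forall J : nat, (J0 <= J)%N ->
         forall sigma : R, 0 <= sigma < 2 * pi ->
         forall lambda : complex R, cabs (lambda - lambda0) < delta ->
           cabs (DJ X a0 a1 sigma lambda J - D sigma lambda) < eps).
Proof.
move=> X0 _ h0 h1.
(* The determinant is taken as the limit along the standard basis; [hD] shows that the limit exists
   for [sigma] in range, so the default [0] does not intervene there. *)
pose D sigma lambda : complex R := xget 0 [set s | cconv (DJ X a0 a1 sigma lambda) s]%classic.
pose h L := Kop_bound X a0 a1 (2 * pi) L.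
have hdom L sigma lambda : 0 <= sigma < 2 * pi -> cabs lambda <= L ->
    dominated (h L) (Kop X a0 a1 sigma lambda).
  by move=> /andP[s0 /ltW s1] lL; apply: Kop_dominated => //; rewrite s0 s1.
have hD sigma lambda : 0 <= sigma < 2 * pi ->
    cconv (DJ X a0 a1 sigma lambda) (D sigma lambda).
  move=> hs; have [B hB] := Kop_bound_summable X0 (2 * pi) (cabs lambda) h0 h1.
  have [s hs'] := det2_stdbasis_cvg hB (Kop_bound_ge0 _ _ _ _ _) (hdom _ _ _ hs (lexx _)).
  exact: (@xgetPex _ 0 [set s | cconv (DJ X a0 a1 sigma lambda) s]%classic) (ex_intro _ s hs').
exists D; split=> [sigma hs lambda|lambda0].
  have [B hB] := Kop_bound_summable X0 (2 * pi) (cabs lambda) h0 h1.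
  apply: (IsDet2_limit hB (Kop_bound_ge0 _ _ _ _ _) (hdom _ _ _ hs (lexx _))).
  exact: hD.
(* On the unit disc around [lambda0] a single majorant serves, with [L = |lambda0| + 1] and [sigma]
   bounded by [2 * pi]. *)
exists 1; split => // eps e0.
have [B hB] := Kop_bound_summable X0 (2 * pi) (cabs lambda0 + 1) h0 h1.
have e20 : 0 < eps / 2 by rewrite divr_gt0.
have [J0 hJ0] := det2_stdbasis_cauchy n hB (Kop_bound_ge0 _ _ _ _ _) e20.
exists J0 => J J0J sigma hs lambda hl.
have lL : cabs lambda <= cabs lambda0 + 1.
  rewrite -[lambda](subrK lambda0) addrC (le_trans (cabsD _ _)) // lerD2l.
  exact: ltW.
have hc := hJ0 J J0J _ (hdom _ _ _ hs lL).
(* Letting the larger truncation tend to infinity in the Cauchy estimate replaces it by [D]. *)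
have := cconv_close (hD sigma lambda hs) hc.
rewrite -/(DJ X a0 a1 sigma lambda J) cabsC => /le_lt_trans; apply.
by rewrite ltr_pdivrMr // ltr_pMr // ltr1n.
Qed.
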